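(* For every integer $a \ge 0$, we have $$R(4,a) = \tfrac{97}{144}a^3 - \tfrac{5}{6}a^2 + \left[\tfrac{44}{48}, \tfrac{47}{48}\right] a + \tfrac{1}{72}\,[0,13,8,-45,40,-19,0,-5,8,-27,40,-37].$$
   Context: A finite lattice is graded of rank $3$ if every maximal chain (from bottom to top) has exactly four elements; its elements then lie on four levels: the bottom, the atoms (elements covering the bottom), the coatoms (elements covered by the top), and the top. For integers $c \ge 1$ and $a \ge 0$, $R(c,a)$ denotes the number of unlabeled graded lattices of rank $3$ (that is, the number of isomorphism classes of such lattices) with exactly $c$ coatoms and exactly $a$ atoms; in particular $R(c,0)=0$. Notation: in a formula depending on an integer variable $a$, the bracket $[c_0, c_1, \ldots, c_{M-1}]$ with $M$ entries denotes the quantity that takes the value $c_k$ when $a \equiv k \pmod M$, $0 \le k \le M-1$. For example $[3,-3]$ means $3$ if $a$ is even and $-3$ if $a$ is odd. *)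

(* Defs.v *)
From HB Require Import structures.
From mathcomp Require Import all_boot all_order all_fingroup all_algebra.

Set Implicit Arguments.
Unset Strict Implicit.
Unset Printing Implicit Defensive.

Import Order.TTheory GRing.Theory Num.Theory.

Section Lattices.

Variables (T : finType) (r : rel T).

Definition partial_order : bool :=
  [&& [forall x, r x x],
      [forall x, forall y, r x y && r y x ==> (x == y)]
    & [forall x, forall y, forall z, r x y && r y z ==> r x z]].

Definition is_meet (x y m : T) : bool :=
  [&& r m x, r m y & [forall z, r z x && r z y ==> r z m]].

Definition is_join (x y j : T) : bool :=
  [&& r x j, r y j & [forall z, r x z && r y z ==> r j z]].

Definition lattice_order : bool :=
  [&& partial_order,
      [forall x, forall y, exists m, is_meet x y m]
    & [forall x, forall y, exists j, is_join x y j]].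

Definition covers (x y : T) : bool :=
  [&& x != y, r x y
    & [forall z, r x z && r z y ==> (z == x) || (z == y)]].

Definition is_bottom (x : T) : bool := [forall y, r x y].
Definition is_top (x : T) : bool := [forall y, r y x].

Definition atoms : {set T} := [set x | [exists b, is_bottom b && covers b x]].
Definition coatoms : {set T} := [set x | [exists t, is_top t && covers x t]].

Definition chain (C : {set T}) : bool :=
  [forall x in C, forall y in C, r x y || r y x].

Definition graded_rank3 : bool :=
  [forall C : {set T}, maxset chain C ==> (#|C| == 4)].

Definition rank3_lattice (c a : nat) : bool :=
  [&& lattice_order, graded_rank3, #|coatoms| == c & #|atoms| == a].

End Lattices.

(* A labeled order on T is encoded by its graph, so that orders form a finType. *)
Definition graph_rel (T : finType) (G : {set T * T}) : rel T :=
  fun x y => (x, y) \in G.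

Definition order_iso (T : finType) (G H : {set T * T}) : bool :=
  [exists f : {perm T}, [forall x, forall y,
     graph_rel G x y == graph_rel H (f x) (f y)]].

(* A graded lattice of rank 3 with c coatoms and a atoms has c + a + 2 elements
   (rank3_lattice_card), so every isomorphism class has a
   representative carried by 'I_(c + a).+2. *)
Definition R (c a : nat) : nat :=
  #|equivalence_partition (@order_iso 'I_(c + a).+2)
      [set G : {set 'I_(c + a).+2 * 'I_(c + a).+2}
         | rank3_lattice (graph_rel G) c a]|.

Definition bracket (s : seq rat) (a : nat) : rat := nth 0%R s (a %% size s).

Section Lemmas.

Variable T : finType.

Lemma order_isoP (G H : {set T * T}) :
  reflect (exists f : {perm T},
             forall x y, graph_rel G x y = graph_rel H (f x) (f y))
          (order_iso G H).
Proof.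
apply: (iffP existsP) => -[f fP]; exists f.
  by move=> x y; apply/eqP; exact: (forallP (forallP fP x)).
by apply/forallP=> x; apply/forallP=> y; rewrite fP.
Qed.

Lemma order_iso_equiv : equivalence_rel (@order_iso T).
Proof.
have refl : reflexive (@order_iso T).
  by move=> G; apply/order_isoP; exists 1%g => x y; rewrite !perm1.
have sym : symmetric (@order_iso T).
  suff imp : forall G H : {set T * T}, order_iso G H -> order_iso H G.
    by move=> G H; apply/idP/idP; apply: imp.
  move=> G H /order_isoP[f fP]; apply/order_isoP; exists f^-1%g => x y.
  by rewrite fP !permKV.
have trans : transitive (@order_iso T).
  move=> H G K /order_isoP[f fP] /order_isoP[g gP].
  by apply/order_isoP; exists (f * g)%g => x y; rewrite fP gP !permM.
by apply/equivalence_relP; split=> // G H; exact: left_trans.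
Qed.

Variable r : rel T.

Lemma partial_orderP :
  reflect [/\ reflexive r, antisymmetric r & transitive r] (partial_order r).
Proof.
apply: (iffP and3P) => -[h1 h2 h3]; split.
- by move=> x; exact: (forallP h1).
- by move=> x y xy; apply/eqP; have /forallP/(_ y)/implyP := forallP h2 x; exact.
- move=> y x z xy yz; have /forallP/(_ y)/forallP/(_ z)/implyP := forallP h3 x.
  by apply; rewrite xy.
- by apply/forallP.
- apply/forallP=> x; apply/forallP=> y; apply/implyP=> xy.
  by rewrite (h2 _ _ xy).
- apply/forallP=> x; apply/forallP=> y; apply/forallP=> z.
  by apply/implyP=> /andP[]; exact: h3.
Qed.

Lemma exists_bottom : lattice_order r -> 0 < #|T| -> exists b, is_bottom r b.
Proof.
case/and3P=> /partial_orderP[rr ra rt] /forallP meet _ /card_gt0P[x0 _].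
case: (arg_minnP (fun x => #|[set y | r y x]|) (isT : xpredT x0)) => b _ bmin.
exists b; apply/forallP=> y.
have /existsP[m /and3P[mb my _]] := forallP (meet b) y.
suff bm : r b m by exact: rt my.
have sub : [set z | r z m] \subset [set z | r z b].
  by apply/subsetP=> z; rewrite !inE => /rt; apply.
have : b \in [set z | r z b] by rewrite inE rr.
suff /eqP<- : [set z | r z m] == [set z | r z b] by rewrite inE.
by rewrite eqEcard sub bmin.
Qed.

Lemma exists_top : lattice_order r -> 0 < #|T| -> exists t, is_top r t.
Proof.
case/and3P=> /partial_orderP[rr ra rt] _ /forallP join /card_gt0P[x0 _].
case: (arg_minnP (fun x => #|[set y | r x y]|) (isT : xpredT x0)) => t _ tmin.
exists t; apply/forallP=> y.
have /existsP[j /and3P[tj yj _]] := forallP (join t) y.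
suff jt : r j t by exact: rt jt.
have sub : [set z | r j z] \subset [set z | r t z].
  by apply/subsetP=> z; rewrite !inE => /(rt _ _ _ tj).
have : t \in [set z | r t z] by rewrite inE rr.
suff /eqP<- : [set z | r j z] == [set z | r t z] by rewrite inE.
by rewrite eqEcard sub tmin.
Qed.

Lemma rank3_lattice_card c a : rank3_lattice r c a -> #|T| = (c + a).+2.
Proof.
case/and4P=> lat /forallP grad /eqP<- /eqP<-.
have /and3P[/partial_orderP[rr ra rt] _ _] := lat.
have ext C : chain r C -> exists2 D : {set T},
    chain r D /\ #|D| = 4 & C \subset D.
  move=> /maxset_exists[D maxD CD]; exists D => //.
  split; first by case/maxsetP: maxD.
  by apply/eqP; have /implyP := grad D; exact.
have cardT : 4 <= #|T|.
  have [|D [_ <-] _] := ext set0; last exact: max_card.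
  by apply/forall_inP=> x; rewrite inE.
have T_gt0 : 0 < #|T| by case: #|T| cardT.
have [b /forallP bP] := exists_bottom lat T_gt0.
have [t /forallP tP] := exists_top lat T_gt0.
have bE b' : is_bottom r b' -> b' = b.
  by move=> /forallP b'P; apply: ra; rewrite b'P bP.
have tE t' : is_top r t' -> t' = t.
  by move=> /forallP t'P; apply: ra; rewrite t'P tP.
have chain4 s : pairwise r s -> uniq s -> size s <= 4.
  move=> ps us; have [|D [_ <-] /subset_leq_card] := ext [set x in s].
    apply/forall_inP=> x; rewrite inE => xs.
    apply/forall_inP=> y; rewrite inE => ys.
    have r_nth i j : i < j < size s -> r (nth b s i) (nth b s j).
      case/andP=> ij js; move/(pairwiseP b): ps; apply=> //.
      exact: ltn_trans js.
    rewrite -(nth_index b xs) -(nth_index b ys).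
    case: (ltngtP (index x s) (index y s)) => [lt|lt|->]; last by rewrite rr.
    - by rewrite r_nth // lt index_mem.
    - by rewrite orbC r_nth // lt index_mem.
  by rewrite cardsE (card_uniqP us).
have atomE x : (x \in atoms r) = covers r b x.
  rewrite inE; apply/existsP/idP => [[b' /andP[/bE->]] //|bx].
  by exists b; rewrite bx andbT; apply/forallP.
have coatomE x : (x \in coatoms r) = covers r x t.
  rewrite inE; apply/existsP/idP => [[t' /andP[/tE->]] //|xt].
  by exists t; rewrite xt andbT; apply/forallP.
have fourth x : exists2 y, y \notin [:: b; x; t] & r x y || r y x.
  have [|D [/forall_inP chD cD] sub] := ext [set z in [:: b; x; t]].
    apply/forall_inP=> u; rewrite !inE => /or3P[]/eqP->;
    apply/forall_inP=> v; rewrite !inE => /or3P[]/eqP->;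
    by rewrite ?rr ?bP ?tP ?orbT.
  have [y yD yN] : exists2 y, y \in D & y \notin [set z in [:: b; x; t]].
    apply/subsetPn; apply/negP=> /subset_leq_card; rewrite cD leqNgt.
    by rewrite cardsE ltnS card_size.
  exists y; first by rewrite inE in yN.
  have xD : x \in D by apply: (subsetP sub); rewrite !inE eqxx orbT.
  by have /forall_inP := chD x xD; exact.
have bNt : b != t.
  have [y + _] := fourth b; apply: contraNneq => eq_bt.
  rewrite !inE; apply/orP; left; apply/eqP; apply: ra.
  by rewrite bP [in r y b]eq_bt tP.
have level x : x \notin [set b; t] ->
    (x \in coatoms r) = ~~ (x \in atoms r).
  move=> xN; have /andP[xb xt] : (x != b) && (x != t).
    by move: xN; rewrite !inE negb_or.
  rewrite atomE coatomE.
  have [y] := fourth x; rewrite !inE !negb_or => /and3P[yb yx yt] xy.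
  case/orP: xy => xy.
  - have -> : covers r x t = false.
      apply/negP=> /and3P[_ _ /forallP/(_ y)/implyP].
      by rewrite xy tP (negPf yx) (negPf yt) => /(_ isT).
    symmetry; apply/negbTE; rewrite negbK /covers eq_sym xb bP /=.
    apply/forallP=> z; apply/implyP=> /andP[bz zx].
    apply: contraT; rewrite negb_or => /andP[zb zNx].
    have zy := rt _ _ _ zx xy.
    suff : size [:: b; z; x; y; t] <= 4 by [].
    apply: chain4; first by rewrite /= !bP !tP zx zy xy.
    rewrite /= !inE !negb_or bNt xt yt zNx ![b == _]eq_sym zb xb yb.
    rewrite [x == y]eq_sym yx !andbT /=; apply/andP; split.
      by apply: contraNneq yx => zy'; apply/eqP/ra; rewrite -{1}zy' zx xy.
    by apply: contraNneq xt => zt; apply/eqP/ra; rewrite tP -zt zx.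
  - have -> : covers r b x = false.
      apply/negP=> /and3P[_ _ /forallP/(_ y)/implyP].
      by rewrite xy bP (negPf yx) (negPf yb) => /(_ isT).
    rewrite /covers xt tP /=.
    apply/forallP=> z; apply/implyP=> /andP[xz zt].
    apply: contraT; rewrite negb_or => /andP[zNx zNt].
    have yz := rt _ _ _ xy xz.
    suff : size [:: b; y; x; z; t] <= 4 by [].
    apply: chain4; first by rewrite /= !bP !tP xz yz xy.
    rewrite /= !inE !negb_or bNt xt yt zNt ![b == _]eq_sym yb xb yx.
    rewrite [x == z]eq_sym zNx !andbT /=; apply/andP; split.
      by apply: contraNneq xb => zb; apply/eqP/ra; rewrite bP andbT -zb.
    by apply: contraNneq yx => yz'; apply/eqP/ra; rewrite xy yz' xz.
have [x0 x0N _] := fourth b.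
have {x0N} [x0b x0t] : x0 != b /\ x0 != t.
  by move: x0N; rewrite !inE !negb_or => /and3P[].
have ends x : x \in [set b; t] -> (x \notin atoms r) && (x \notin coatoms r).
  rewrite atomE coatomE !inE => /orP[]/eqP->; rewrite /covers eqxx ?andbT /=.
  - by apply/negP=> /and3P[_ _ /forallP/(_ x0)];
      rewrite bP tP (negPf x0b) (negPf x0t).
  - by apply/negP=> /and3P[_ _ /forallP/(_ x0)];
      rewrite bP tP (negPf x0b) (negPf x0t).
have dis : [disjoint coatoms r & atoms r].
  apply/pred0P=> x /=; case: (boolP (x \in [set b; t])) => [/ends|/level->].
    by case/andP=> /negPf-> _; rewrite andbF.
  by rewrite andNb.
have -> : #|T| = #|[set b; t]| + #|~: [set b; t]| by rewrite cardsC.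
rewrite cards2 bNt -cardsUI (disjoint_setI0 dis) cards0 addn0.
congr _.+2; apply: eq_card => x; rewrite inE [RHS]inE.
case: (boolP (x \in [set b; t])) => [/ends/andP[/negPf-> /negPf->] //|/level->].
by rewrite orNb.
Qed.

Lemma lattice_orderP :
  reflect (exists d (L : finLatticeType d) (f : T -> L),
             bijective f /\ forall x y, r x y = (f x <= f y)%O)
          (lattice_order r).
Proof.
apply: (iffP idP) => [lat|[d [L [f [[g fK gK] rE]]]]]; last first.
  apply/and3P; split.
  - apply/partial_orderP; split=> [x|x y|y x z]; rewrite !rE //.
    + by move=> /le_anti/(can_inj fK).
    + exact: le_trans.
  - apply/forallP=> x; apply/forallP=> y; apply/existsP.
    exists (g (f x `&` f y)%O); rewrite /is_meet !rE !gK leIl leIr /=.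
    by apply/forallP=> z; rewrite !rE gK lexI implybb.
  - apply/forallP=> x; apply/forallP=> y; apply/existsP.
    exists (g (f x `|` f y)%O); rewrite /is_join !rE !gK leUl leUr /=.
    by apply/forallP=> z; rewrite !rE gK leUx implybb.
have /and3P[/partial_orderP[rr ra rt] /forallP meet /forallP join] := lat.
have exm x y : exists m, is_meet r x y m by apply/existsP; exact: (forallP (meet x)).
have exj x y : exists j, is_join r x y j by apply/existsP; exact: (forallP (join x)).
pose m x y := xchoose (exm x y); pose j x y := xchoose (exj x y).
have mP x y z : r x (m y z) = r x y && r x z.
  have /and3P[my mz /forallP h] := xchooseP (exm y z).
  apply/idP/idP => [xm|]; last exact: (implyP (h x)).
  by rewrite !(rt _ _ _ xm).
have jP x y z : r (j x y) z = r x z && r y z.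
  have /and3P[jx jy /forallP h] := xchooseP (exj x y).
  apply/idP/idP => [jz|]; last exact: (implyP (h z)).
  by rewrite (rt _ _ _ jx jz) (rt _ _ _ jy jz).
pose d := Order.Disp tt tt.
pose P : porderType d := HB.pack T (Order.Le_isPOrder.Build d T rr ra rt).
pose L : finLatticeType d :=
  HB.pack T P (Order.POrder_MeetJoin_isLattice.Build d P mP jP).
by exists d, L, id; split=> //; exists id.
Qed.

End Lemmas.

(* Main.v *)
(* An element of such a lattice is described by its level together with the set of coatoms
   above it, and these labels determine the order.  Two atoms share at most one coatom, so
   the lattice amounts to a multiset of a nonempty subsets of the coatoms: a linear
   hypergraph h (subsets of size at least 2) and multiplicities for the singletons, at
   least 1 at every coatom not covered by h.  Subtracting these forced singletons leaves
   arbitrary multiplicities n with |n| + |h| + #(uncovered coatoms) = a.  Isomorphism is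
   the action of S_c on the pairs (h, n), so Burnside's lemma applies; for c = 4 there are
   five cycle types and 97 labelled linear hypergraphs. *)
Require Import Defs.
From mathcomp Require Import all_boot all_order all_fingroup all_algebra.
From mathcomp Require Import zify ring.
From Stdlib Require Import FunctionalExtensionality.

Set Implicit Arguments.
Unset Strict Implicit.
Unset Printing Implicit Defensive.

(** * Labels *)

(** Isomorphisms of lattices permute all c + a + 2 elements, whereas Burnside's lemma is to be
    applied to the much smaller group S_c. The passage works because the labels depend on nothing
    but a numbering of the coatoms: an isomorphism only changes this numbering, and labellings with
    equal fibre sizes define isomorphic orders. Finite sets and permutations do not evaluate well,
    so invariant hypergraphs are counted on lists. For a permutation g, the invariant multiplicities
    have as generating function the product of 1/(1 - X^l) over the cycle lengths l of g. These
    series explain the shape of the answer: 97/144 is 97/(24 * 3!); the only multiple pole away from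
    1 is the double pole at -1 for type 22, which gives the linear coefficient its period 2; the
    constant term has period 12, the least common multiple of the cycle lengths. The largest weight
    is 6, so no term of the count is truncated from a = 6 on; smaller a are evaluated one by one. *)

Section Labellings.

Variables (c : nat) (T : finType).
Implicit Types (lab : T -> nat * {set 'I_c}) (x y z : T) (S : {set 'I_c}).

(* A label is a level (0 bottom, 1 atom, 2 coatom, 3 top) and the set of coatoms above. *)
Definition lab_rel lab : rel T := fun x y =>
  (x == y) || ((lab x).1 < (lab y).1) && ((lab y).2 \subset (lab x).2).

(** [lab_coatom], [lab_coatom1] and [lab_coatom_inj] number the coatoms by ['I_c]. [lab_atom0] and
    [lab_cover] prevent maximal chains from skipping a level. [lab_atomI] keeps two atoms from
    having two minimal upper bounds; it also allows only singletons to be repeated as sets of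
    atoms. *)
Record labelling (a : nat) lab : Prop := Labelling {
  lab_bottom : exists b, lab b = (0, setT) /\ forall x, (lab x).1 = 0 -> x = b;
  lab_top : exists t, lab t = (3, set0) /\ forall x, (lab x).1 = 3 -> x = t;
  lab_le3 : forall x, (lab x).1 <= 3;
  lab_coatom : forall i, exists x, lab x = (2, [set i]);
  lab_coatom1 : forall x, (lab x).1 = 2 -> exists i, lab x = (2, [set i]);
  lab_coatom_inj : forall x y, (lab x).1 = 2 -> lab x = lab y -> x = y;
  lab_atom0 : forall x, (lab x).1 = 1 -> (lab x).2 != set0;
  lab_atomI : forall x y, (lab x).1 = 1 -> (lab y).1 = 1 -> x != y ->
    #|(lab x).2 :&: (lab y).2| <= 1;
  lab_cover : forall i, exists x, (lab x).1 = 1 /\ i \in (lab x).2;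
  lab_card : #|[set x | (lab x).1 == 1]| = a
}.

Lemma lab_rel_lt lab x y : lab_rel lab x y -> x != y -> (lab x).1 < (lab y).1.
Proof. by case/orP => [/eqP->|/andP[]//]; rewrite eqxx. Qed.

Lemma lab_rel_partial_order lab : partial_order (lab_rel lab).
Proof.
apply/partial_orderP; split=> [x|x y|y x z]; rewrite /lab_rel ?eqxx //.
  case: eqP => //= _; case: eqP => //= _; lia.
case: (eqVneq x y) => [-> //|_] /= /andP[xy yx].
case: (eqVneq y z) => [<-|_] /=; first by rewrite xy yx orbT.
by case/andP=> yz zy; rewrite (ltn_trans xy yz) (subset_trans zy yx) orbT.
Qed.

(** * A labelling defines a graded lattice of rank 3 *)

Section Structure.

Variables (a : nat) (lab : T -> nat * {set 'I_c}).
Hypotheses (labP : labelling a lab) (c_gt0 : 0 < c).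
Local Notation r := (lab_rel lab).

Lemma lab_level x : [\/ (lab x).1 = 0, (lab x).1 = 1, (lab x).1 = 2 | (lab x).1 = 3].
Proof.
have := lab_le3 labP x.
case: (lab x).1 => [|[|[|[|]]]] // _;
  [exact: Or41|exact: Or42|exact: Or43|exact: Or44].
Qed.

Lemma lab_atom_below x : 1 < (lab x).1 -> exists2 y, (lab y).1 = 1 & r y x.
Proof.
case: (lab_level x) => lx; rewrite lx // => _.
  have [i xi] := lab_coatom1 labP lx; have [y [ly iy]] := lab_cover labP i.
  by exists y; rewrite // /lab_rel ly xi /= sub1set iy orbT.
have [y [ly _]] := lab_cover labP (Ordinal c_gt0).
have [t [tE t1]] := lab_top labP.
by exists y; rewrite // (t1 _ lx) /lab_rel ly tE sub0set orbT.
Qed.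

Lemma lab_coatom_above x : (lab x).1 < 2 -> exists2 y, (lab y).1 = 2 & r x y.
Proof.
case: (lab_level x) => lx; rewrite lx // => _.
  have [y yE] := lab_coatom labP (Ordinal c_gt0).
  have [b [bE b1]] := lab_bottom labP.
  by exists y; rewrite ?yE // (b1 _ lx) /lab_rel bE yE subsetT orbT.
have /set0Pn[i xi] := lab_atom0 labP lx.
have [y yE] := lab_coatom labP i.
by exists y; rewrite /lab_rel yE // lx /= sub1set xi orbT.
Qed.

Lemma lab_rel_bottom b x : (lab b).1 = 0 -> r b x.
Proof.
have [b' [bE b1]] := lab_bottom labP => /b1->; rewrite /lab_rel bE subsetT andbT /=.
case: (lab_level x) => lx; rewrite lx ?orbT //.
by rewrite (b1 _ lx) eqxx.
Qed.

Lemma lab_rel_top x t : (lab t).1 = 3 -> r x t.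
Proof.
have [t' [tE t1]] := lab_top labP => /t1->; rewrite /lab_rel tE sub0set andbT /=.
case: (lab_level x) => lx; rewrite lx ?orbT //.
by rewrite (t1 _ lx) eqxx.
Qed.

Lemma is_bottom_lab x : is_bottom r x = ((lab x).1 == 0).
Proof.
apply/forallP/eqP => [xb|lx y]; last exact: lab_rel_bottom.
have [b [bE b1]] := lab_bottom labP.
have := xb b; rewrite /lab_rel bE /= orbF => /eqP->; by rewrite bE.
Qed.

Lemma is_top_lab x : is_top r x = ((lab x).1 == 3).
Proof.
apply/forallP/eqP => [xt|lx y]; last exact: lab_rel_top.
have [t [tE t1]] := lab_top labP.
have := xt t; rewrite /lab_rel tE /= ltnNge (lab_le3 labP) orbF => /eqP<-.
by rewrite tE.
Qed.

Lemma atoms_lab : atoms r = [set x | (lab x).1 == 1].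
Proof.
have [b [bE b1]] := lab_bottom labP.
apply/setP=> x; rewrite !inE; apply/existsP/eqP => [[b']|lx].
  rewrite is_bottom_lab => /andP[/eqP/b1->] /and3P[bx _ /forallP cov].
  case: (ltngtP (lab x).1 1) => // [lx|/[dup] lx /lab_atom_below[y ly yx]].
    have lx0 : (lab x).1 = 0 by lia.
    by rewrite (b1 _ lx0) eqxx in bx.
  have := cov y; rewrite yx lab_rel_bottom ?bE //=.
  by case/orP=> /eqP E; move: lx ly; rewrite E ?bE //; lia.
exists b; rewrite is_bottom_lab bE /= /covers lab_rel_bottom ?bE //=.
apply/andP; split; first by apply/eqP=> E; rewrite -E bE in lx.
apply/forallP=> z; apply/implyP=> /andP[_ zx].
case: (eqVneq z x) => [->|zNx]; rewrite ?orbT // orbF.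
by have := lab_rel_lt zx zNx; rewrite lx ltnS leqn0 => /eqP/b1->.
Qed.

Lemma coatoms_lab : coatoms r = [set x | (lab x).1 == 2].
Proof.
have [t [tE t1]] := lab_top labP.
apply/setP=> x; rewrite !inE; apply/existsP/eqP => [[t']|lx].
  rewrite is_top_lab => /andP[/eqP/t1->] /and3P[xt _ /forallP cov].
  case: (ltngtP (lab x).1 2) => // [/[dup] lx /lab_coatom_above[y ly xy]|lx].
    have := cov y; rewrite xy lab_rel_top ?tE //=.
    by case/orP=> /eqP E; move: lx ly; rewrite E ?tE //; lia.
  have lx3 : (lab x).1 = 3 by have := lab_le3 labP x; lia.
  by rewrite (t1 _ lx3) eqxx in xt.
exists t; rewrite is_top_lab tE /= /covers lab_rel_top ?tE //=.
apply/andP; split; first by apply/eqP=> E; rewrite E tE in lx.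
apply/forallP=> z; apply/implyP=> /andP[xz _].
case: (eqVneq z x) => [->|zNx] //=; apply/eqP; apply: t1.
have := lab_le3 labP z; rewrite eq_sym in zNx.
by have := lab_rel_lt xz zNx; rewrite lx; lia.
Qed.

Lemma card_coatoms_lab : #|coatoms r| = c.
Proof.
have inj : {in coatoms r &, injective (fun x => (lab x).2)}.
  move=> x y; rewrite coatoms_lab !inE => /eqP lx /eqP ly E.
  apply: (lab_coatom_inj labP lx); move: E lx ly.
  by case: (lab x) (lab y) => [? ?] [? ?] /= -> -> ->.
rewrite -(card_in_imset inj) -[RHS]card_ord -cardsT -(card_imset _ (@set1_inj 'I_c)).
congr #|pred_of_set _|; apply/setP=> S; apply/imsetP/imsetP.
  case=> x; rewrite coatoms_lab inE => /eqP /(lab_coatom1 labP)[i ->] ->.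
  by exists i.
case=> i _ ->; have [x xE] := lab_coatom labP i.
by exists x; rewrite ?coatoms_lab ?inE xE.
Qed.

(** If x and y are incomparable, a common lower bound is the bottom or an atom. An atom forces x and
    y to be coatoms, and a second such atom would share both of them with the first, against
    [lab_atomI]. *)
Lemma lab_rel_meet x y : exists m, is_meet r x y m.
Proof.
have /partial_orderP[rr ra rt] := lab_rel_partial_order lab.
have [xy|Nxy] := boolP (r x y).
  by exists x; rewrite /is_meet rr xy; apply/forallP=> z; apply/implyP=> /andP[].
have [yx|Nyx] := boolP (r y x).
  by exists y; rewrite /is_meet rr yx; apply/forallP=> z; apply/implyP=> /andP[].
have low z : r z x -> r z y -> (lab z).1 < (lab x).1 /\ (lab z).1 < (lab y).1.
  by move=> zx zy; split; apply: lab_rel_lt => //;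
    [apply: contraNneq Nxy => <-|apply: contraNneq Nyx => <-].
have x3 : (lab x).1 != 3 by apply: contraNneq Nyx => ?; exact: lab_rel_top.
have y3 : (lab y).1 != 3 by apply: contraNneq Nxy => ?; exact: lab_rel_top.
have [b [bE b1]] := lab_bottom labP.
have [z /and3P[/eqP lz zx zy]|none] :=
    pickP [pred z | [&& (lab z).1 == 1, r z x & r z y]]; last first.
  exists b; rewrite /is_meet !lab_rel_bottom ?bE //=; apply/forallP=> z.
  apply/implyP=> /andP[zx zy]; have [zx' zy'] := low z zx zy.
  have := none z; rewrite /= zx zy !andbT => lz; rewrite (b1 z) ?rr //.
  by move: (lab_le3 labP x) lz x3; lia.
exists z; rewrite /is_meet zx zy; apply/forallP=> z'; apply/implyP=> /andP[zx' zy'].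
have [? ?] := low z zx zy; have [? ?] := low z' zx' zy'.
have lx : (lab x).1 = 2 by move: (lab_le3 labP x) x3; lia.
have ly : (lab y).1 = 2 by move: (lab_le3 labP y) y3; lia.
case: (lab_level z') => lz'; try by lia.
  exact: lab_rel_bottom.
case: (eqVneq z' z) => [->|/(lab_atomI labP lz' lz)]; first exact: rr.
rewrite leqNgt => /negP[]; have [i xi] := lab_coatom1 labP lx.
have [j yj] := lab_coatom1 labP ly.
have xNy : x != y by apply: contraNneq Nxy => ->; rewrite rr.
have ij : i != j.
  by apply: contraNneq xNy => E; apply/eqP/(lab_coatom_inj labP lx); rewrite xi yj E.
have mem u v k : (lab u).1 = 1 -> lab v = (2, [set k]) -> r u v -> k \in (lab u).2.
  move=> lu vk; rewrite /lab_rel vk /= sub1set; case: eqP => [E|_ /andP[]//].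
  by rewrite E vk in lu.
by apply/card_gt1P; exists i, j; rewrite !inE !(mem _ _ _ lz' xi, mem _ _ _ lz' yj,
  mem _ _ _ lz xi, mem _ _ _ lz yj).
Qed.

(** Dual to the meet: two coatoms above the same two atoms again contradict [lab_atomI]. *)
Lemma lab_rel_join x y : exists j, is_join r x y j.
Proof.
have /partial_orderP[rr ra rt] := lab_rel_partial_order lab.
have [xy|Nxy] := boolP (r x y).
  by exists y; rewrite /is_join rr xy; apply/forallP=> z; apply/implyP=> /andP[].
have [yx|Nyx] := boolP (r y x).
  by exists x; rewrite /is_join rr yx; apply/forallP=> z; apply/implyP=> /andP[].
have high z : r x z -> r y z -> (lab x).1 < (lab z).1 /\ (lab y).1 < (lab z).1.
  by move=> zx zy; split; apply: lab_rel_lt => //;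
    [apply: contraNneq Nyx => ->|apply: contraNneq Nxy => ->].
have x0 : (lab x).1 != 0 by apply: contraNneq Nxy => ?; exact: lab_rel_bottom.
have y0 : (lab y).1 != 0 by apply: contraNneq Nyx => ?; exact: lab_rel_bottom.
have [t [tE t1]] := lab_top labP.
have [z /and3P[/eqP lz xz yz]|none] :=
    pickP [pred z | [&& (lab z).1 == 2, r x z & r y z]]; last first.
  exists t; rewrite /is_join !lab_rel_top ?tE //=; apply/forallP=> z.
  apply/implyP=> /andP[xz yz]; have [xz' yz'] := high z xz yz.
  have := none z; rewrite /= xz yz !andbT => lz; rewrite (t1 z) ?rr //.
  by move: (lab_le3 labP z) lz x0; lia.
exists z; rewrite /is_join xz yz; apply/forallP=> z'; apply/implyP=> /andP[xz' yz'].
have [? ?] := high z xz yz; have [? ?] := high z' xz' yz'.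
have lx : (lab x).1 = 1 by lia.
have ly : (lab y).1 = 1 by lia.
case: (lab_level z') => lz'; try by lia.
  case: (eqVneq z z') => [->|zNz']; first exact: rr.
  have xNy : x != y by apply: contraNneq Nxy => ->; rewrite rr.
  have := lab_atomI labP lx ly xNy.
  rewrite leqNgt => /negP[]; have [i zi] := lab_coatom1 labP lz.
  have [j zj] := lab_coatom1 labP lz'.
  have ij : i != j.
    by apply: contraNneq zNz' => E; apply/eqP/(lab_coatom_inj labP lz); rewrite zi zj E.
  have mem u v k : (lab u).1 = 1 -> lab v = (2, [set k]) -> r u v -> k \in (lab u).2.
    move=> lu vk; rewrite /lab_rel vk /= sub1set; case: eqP => [E|_ /andP[]//].
    by rewrite E vk in lu.
  by apply/card_gt1P; exists i, j; rewrite !inE !(mem _ _ _ lx zi, mem _ _ _ lx zj,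
    mem _ _ _ ly zi, mem _ _ _ ly zj).
exact: lab_rel_top.
Qed.

(** By maximality a chain contains every element comparable with all its members, so it meets each
    of the four levels; strictly comparable elements have different levels, so it meets each level
    once. *)
Lemma lab_rel_graded : graded_rank3 r.
Proof.
have /partial_orderP[rr ra rt] := lab_rel_partial_order lab.
have [b [bE b1]] := lab_bottom labP; have [t [tE t1]] := lab_top labP.
apply/forallP=> C; apply/implyP=> /maxsetP[/forall_inP chC maxC].
have ext z : (forall x, x \in C -> r x z || r z x) -> z \in C.
  move=> zC; rewrite -(maxC (z |: C)) ?subsetUr ?setU11 //.
  apply/forall_inP=> x /setU1P[->|xC]; apply/forall_inP=> y /setU1P[->|yC].
  - by rewrite rr.
  - by rewrite orbC zC.
  - by rewrite zC.
  - exact: (forall_inP (chC _ xC)).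
have bC : b \in C by apply: ext => x _; rewrite [r b x]lab_rel_bottom ?bE ?orbT.
have tC : t \in C by apply: ext => x _; rewrite lab_rel_top ?tE.
have inj : {in C &, injective (fun x => (lab x).1)}.
  move=> x y xC yC E; have /orP := forall_inP (chC _ xC) _ yC.
  case: (eqVneq x y) => // xNy [/lab_rel_lt|/lab_rel_lt]; first by move/(_ xNy); lia.
  by rewrite eq_sym => /(_ xNy); lia.
(* If level 2 is missing and x is the largest member of lower level, any coatom above x could be
   added to the chain. *)
have coat k x : k < 2 -> x \in C -> (lab x).1 = k -> (forall y, y \in C -> (lab y).1 <> 2) ->
    (forall y, y \in C -> (lab y).1 < 2 -> r y x) -> False.
  move=> k2 xC lx no2 low.
  have [y ly xy] : exists2 y, (lab y).1 = 2 & r x y by apply: lab_coatom_above; lia.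
  apply: (no2 y) => //; apply: ext => z zC.
  case: (lab_level z) => lz.
  - by rewrite (rt _ _ _ (low z zC _) xy) // lz.
  - by rewrite (rt _ _ _ (low z zC _) xy) // lz.
  - by case: (no2 z).
  - by rewrite [r y z]lab_rel_top ?orbT.
have [x1 x1C /eqP l1] : exists2 x, x \in C & (lab x).1 == 1.
  apply/exists_inP; apply: contraT => /exists_inPn/= no1; exfalso.
  have [x xC /eqP lx] : exists2 x, x \in C & (lab x).1 == 2.
    apply/exists_inP; apply: contraT => /exists_inPn/= no2; exfalso.
    apply: (coat 0 b _ bC); rewrite ?bE // => y yC; first by apply/eqP/no2.
    by move=> ly; have := no1 y yC; have -> : y = b by apply: b1; have := no1 y yC; lia.
  have [y ly yx] : exists2 y, (lab y).1 = 1 & r y x by apply: lab_atom_below; rewrite lx.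
  have /no1 : y \in C; last by rewrite ly.
  apply: ext => z zC; case: (lab_level z) => lz.
  - by rewrite lab_rel_bottom.
  - by have := no1 z zC; rewrite lz.
  - by rewrite (inj z x) ?yx ?orbT // lz.
  - by rewrite orbC lab_rel_top.
have [x2 x2C /eqP l2] : exists2 x, x \in C & (lab x).1 == 2.
  apply/exists_inP; apply: contraT => /exists_inPn/= no2; exfalso.
  apply: (coat 1 x1 _ x1C) => // y yC; first exact/eqP/no2.
  case: (lab_level y) => ly; rewrite ly // => _; first exact: lab_rel_bottom.
  by rewrite (inj y x1) ?rr // ly.
have lev01 : b != x1 by apply/eqP=> E; rewrite -E bE in l1.
have lev02 : b != x2 by apply/eqP=> E; rewrite -E bE in l2.
have lev03 : b != t by apply/eqP=> E; rewrite -E bE in tE.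
have lev12 : x1 != x2 by apply/eqP=> E; rewrite -E l1 in l2.
have lev13 : x1 != t by apply/eqP=> E; rewrite E tE in l1.
have lev23 : x2 != t by apply/eqP=> E; rewrite E tE in l2.
have -> : C = [set z in [:: b; x1; x2; t]].
  apply/setP=> z; rewrite !inE; apply/idP/idP => [zC|/or4P[]/eqP->//].
  case: (lab_level z) => lz; rewrite -?(b1 _ lz) -?(t1 _ lz) ?eqxx ?orbT //.
    by rewrite (inj z x1) ?eqxx ?orbT // lz.
  by rewrite (inj z x2) ?eqxx ?orbT // lz.
rewrite cardsE; apply/eqP/card_uniqP.
by rewrite /= !inE !negb_or lev01 lev02 lev03 lev12 lev13 lev23.
Qed.

Lemma lab_rel_rank3 : rank3_lattice r c a.
Proof.
apply/and4P; split; last 2 first.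
- by rewrite card_coatoms_lab.
- by rewrite atoms_lab (lab_card labP).
- apply/and3P; split; first exact: lab_rel_partial_order.
    by apply/forallP=> x; apply/forallP=> y; apply/existsP; exact: lab_rel_meet.
  by apply/forallP=> x; apply/forallP=> y; apply/existsP; exact: lab_rel_join.
exact: lab_rel_graded.
Qed.

(* Characterizes the level in terms of the order alone. *)
Lemma lab_gtP k x :
  reflect (exists2 y, (y != x) && r y x & k <= (lab y).1) (k < (lab x).1).
Proof.
apply: (iffP idP) => [kx|[y /andP[yx ryx]]]; last first.
  by move/leq_ltn_trans; apply; exact: lab_rel_lt.
suff [y yx ly] : exists2 y, r y x & (lab y).1 = (lab x).1.-1.
  exists y; last by rewrite ly; lia.
  by rewrite yx andbT; apply/eqP=> E; move: ly; rewrite E; lia.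
have [b [bE b1]] := lab_bottom labP; case: (lab_level x) => lx; rewrite lx //= in kx *.
- by exists b; rewrite ?bE ?lab_rel_bottom ?bE.
- by have [|y] := @lab_atom_below x; rewrite ?lx //; exists y.
have [|y ly] := @lab_coatom_above b; rewrite ?bE // => _.
by exists y; rewrite ?lab_rel_top.
Qed.

Lemma mem_lab_atom i x y : (lab x).1 = 1 -> lab y = (2, [set i]) ->
  (i \in (lab x).2) = r x y.
Proof.
move=> lx yE; rewrite /lab_rel yE lx sub1set /=.
by case: eqP => // E; rewrite E yE in lx.
Qed.

End Structure.

(** The order determines the levels by [lab_gtP], and the set of an atom by [mem_lab_atom] once the
    coatoms are named. Only the naming is free: [s] sends the name of each coatom under [lab] to its
    name under [lab']. *)
Lemma labelling_unique a a' lab lab' : 0 < c -> labelling a lab -> labelling a' lab' ->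
    lab_rel lab =2 lab_rel lab' ->
  exists s : 'S_c, forall x, lab' x = ((lab x).1, s @: (lab x).2).
Proof.
move=> c_gt0 labP labP' eqr.
have lev x : (lab' x).1 = (lab x).1.
  have lev k : forall z, (k <= (lab z).1) = (k <= (lab' z).1).
    elim: k => // k IH z; apply/(lab_gtP labP c_gt0)/(lab_gtP labP' c_gt0) => -[y];
      by [rewrite eqr IH; exists y|rewrite -eqr -IH; exists y].
  by apply/eqP; rewrite eqn_leq lev leqnn -lev leqnn.
have /fin_all_exists[p pP] i : exists x, lab x = (2, [set i]) by exact: lab_coatom labP i.
have /fin_all_exists[s sP] i : exists j, lab' (p i) = (2, [set j]).
  by apply: (lab_coatom1 labP'); rewrite lev pP.
have s_inj : injective s.
  move=> i j sij; apply: set1_inj; suff : lab (p i) = lab (p j) by rewrite !pP => -[].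
  by congr lab; apply: (lab_coatom_inj labP'); rewrite !sP ?sij.
exists (perm s_inj) => x; rewrite [LHS]surjective_pairing lev; congr pair.
case: (lab_level labP x) => lx.
- have [b [bE b1]] := lab_bottom labP; have [b' [bE' b1']] := lab_bottom labP'.
  have xb : x = b by exact: b1.
  have xb' : x = b' by apply: b1'; rewrite lev.
  rewrite {1}xb' xb bE bE' /=; apply/setP=> i; rewrite inE; symmetry; apply/imsetP.
  by exists ((perm s_inj)^-1%g i); rewrite ?inE ?permKV.
- apply/setP=> i; rewrite -[i](permKV (perm s_inj)).
  rewrite (mem_imset _ _ (@perm_inj _ _)); set j := _ i.
  rewrite (mem_lab_atom lx (pP j)) eqr.
  by apply: mem_lab_atom; rewrite ?lev // sP permE.
- have [i xi] := lab_coatom1 labP lx.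
  have -> : x = p i by apply: (lab_coatom_inj labP); rewrite // xi pP.
  by rewrite sP pP /= imset_set1 permE.
- have [b [bE b1]] := lab_top labP; have [b' [bE' b1']] := lab_top labP'.
  have xb : x = b by exact: b1.
  have xb' : x = b' by apply: b1'; rewrite lev.
  by rewrite {1}xb' xb bE bE' /= imset0.
Qed.

End Labellings.

(** * Labelling a lattice of rank 3 *)

Section Rank3Structure.

Variables (T : finType) (r : rel T) (c a : nat).
Hypothesis rP : rank3_lattice r c a.

Let ord : partial_order r.
Proof. by case/and4P: rP => /and3P[]. Qed.

Let rr : reflexive r. Proof. by case/partial_orderP: ord. Qed.
Let ra : antisymmetric r. Proof. by case/partial_orderP: ord. Qed.
Let rt : transitive r. Proof. by case/partial_orderP: ord. Qed.

(** Serves in two ways: five distinct elements in increasing order are impossible, and a shorter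
    chain always acquires a further comparable element. *)
Lemma rank3_chain_ext (s : seq T) : pairwise r s -> uniq s ->
  exists D : {set T}, [/\ chain r D, #|D| = 4 & {subset s <= D}].
Proof.
move=> ps us; case/and4P: rP => _ /forallP grad _ _.
have ch : chain r [set x in s].
  apply/forall_inP=> x; rewrite inE => xs; apply/forall_inP=> y; rewrite inE => ys.
  move/(pairwiseP x): (ps) => nth_r.
  rewrite -(nth_index x xs) -(nth_index x ys).
  case: (ltngtP (index x s) (index y s)) => [lt|lt|->]; last by rewrite rr.
  - by rewrite nth_r ?inE ?index_mem.
  - by rewrite orbC nth_r ?inE ?index_mem.
have [D maxD sD] := maxset_exists ch.
exists D; split; first by case/maxsetP: maxD.
  by apply/eqP; exact: (implyP (grad D)).
by move=> x xs; apply: (subsetP sD); rewrite inE.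
Qed.

Lemma rank3_ends : exists b t, [/\ forall x, r b x, forall x, r x t & b != t].
Proof.
have [D [_ D4 _]] := @rank3_chain_ext [::] isT isT.
have T_gt0 : 0 < #|T| by apply: leq_trans (max_card D); rewrite D4.
case/and4P: (rP) => lat _ _ _.
have [b /forallP bP] := exists_bottom lat T_gt0.
have [t /forallP tP] := exists_top lat T_gt0.
exists b, t; split=> //; apply/eqP=> bt.
have all_b x : x = b by apply: ra; rewrite bP [in r x b]bt tP.
suff : #|D| <= 1 by rewrite D4.
by apply/card_le1P=> x xD y; rewrite inE (all_b y) -(all_b x) xD eqxx.
Qed.


Lemma rank3_labelling : 0 < c ->
  exists2 lab : T -> nat * {set 'I_c}, labelling a lab & r =2 lab_rel lab.
Proof.
move=> c_gt0; have [b [t [bP tP bNt]]] := rank3_ends.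
have bE x : r x b -> x = b by move=> xb; apply: ra; rewrite xb bP.
have tE x : r t x -> x = t by move=> tx; apply: ra; rewrite tx tP.
(* Together with [b] and [t] these would form a chain of five elements. *)
have no5 x y z : r x y -> r y z -> x != y -> y != z -> x != b -> z != t -> False.
  move=> xy yz xNy yNz xb zt; have xz := rt xy yz.
  have yb : y != b by apply: contraNneq xb => yb; rewrite yb in xy; rewrite (bE _ xy).
  have yt : y != t by apply: contraNneq zt => yt; rewrite yt in yz; rewrite (tE _ yz).
  have zb : z != b by apply: contraNneq yb => zb; rewrite zb in yz; rewrite (bE _ yz).
  have xt : x != t by apply: contraNneq yt => xt; rewrite xt in xy; rewrite (tE _ xy).
  have xNz : x != z.
    by apply: contraNneq xNy => xz'; apply/eqP/ra; rewrite xy xz' yz.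
  have us : uniq [:: b; x; y; z; t].
    by rewrite /= !inE !negb_or bNt xNy xNz xt yNz yt zt ![b == _]eq_sym xb yb zb.
  have [|D [_ D4 sD]] := @rank3_chain_ext [:: b; x; y; z; t] _ us.
    by rewrite /= !bP !tP xy xz yz.
  suff : 5 <= #|D| by rewrite D4.
  have /= <- := card_uniqP us; apply/subset_leq_card/subsetP => u; exact: sD.
have fourth x : exists y, [/\ y != b, y != x, y != t & r x y || r y x].
  suff [y] : exists2 y, y \notin [:: b; x; t] & r x y || r y x.
    by rewrite !inE !negb_or => /and3P[? ? ?] ?; exists y.
  (* The chain to be extended is passed as [s] without repetition, since x may itself be [b] or
     [t]. *)
  have sz (s : seq T) : size s < 4 -> pairwise r s -> uniq s ->
      {subset [:: b; x; t] <= s} -> exists2 y, y \notin [:: b; x; t] & r x y || r y x.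
    move=> s4 ps us ss; have [D [/forall_inP chD D4 sD]] := rank3_chain_ext ps us.
    have [y yD yNs] : exists2 y, y \in D & y \notin s.
      apply/subsetPn; apply: contraL s4 => /subset_leq_card.
      by rewrite D4 -leqNgt => /leq_trans; apply; exact: card_size.
    exists y; first by apply: contra yNs; exact: ss.
    by apply: (forall_inP (chD _ (sD _ _))) => //; apply: ss; rewrite !inE eqxx orbT.
  have [xbt|] := boolP (x \in [:: b; t]).
    apply: (sz [:: b; t]); rewrite //= ?bP ?inE ?bNt //.
    move=> z; rewrite !inE => /or3P[] /eqP->; rewrite ?eqxx ?orbT //.
    by rewrite !inE in xbt.
  rewrite !inE negb_or => /andP[xb xt].
  by apply: (sz [:: b; x; t]); rewrite //= ?bP ?tP ?inE ?negb_or ?bNt ?xt 1?eq_sym ?xb.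
have atomE x : (x \in atoms r) = covers r b x.
  rewrite inE; apply/existsP/idP => [[b' /andP[/forallP b'P]]|bx].
    by rewrite (bE b' (b'P b)).
  by exists b; rewrite bx andbT; apply/forallP.
have coatomE x : (x \in coatoms r) = covers r x t.
  rewrite inE; apply/existsP/idP => [[t' /andP[/forallP t'P]]|xt].
    by rewrite (tE t' (t'P t)).
  by exists t; rewrite xt andbT; apply/forallP.
(* An element strictly between [b] and x, or between y and [t], would contradict [no5]. *)
have step x y : r x y -> x != y -> x != b -> y != t -> x \in atoms r /\ y \in coatoms r.
  move=> xy xNy xb yt; rewrite atomE coatomE /covers bP tP yt [b == x]eq_sym xb /=.
  split; apply/forallP=> z; apply/implyP=> /andP[h1 h2]; apply: contraT;
    rewrite negb_or => /andP[z1 z2].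
  - by case: (no5 z x y).
  - by case: (no5 x y z); rewrite // eq_sym.
have disj x : x \in atoms r -> x \in coatoms r -> False.
  rewrite atomE coatomE => /and3P[_ _ /forallP h1] /and3P[_ _ /forallP h2].
  have [y [yb yx yt /orP[xy|yx']]] := fourth x.
    by have := h2 y; rewrite xy tP (negPf yx) (negPf yt).
  by have := h1 y; rewrite yx' bP (negPf yx) (negPf yb).
have bA : b \notin atoms r by rewrite atomE /covers eqxx.
have tC : t \notin coatoms r by rewrite coatomE /covers eqxx.
have [y0 y0b y0t] : exists2 y, y != b & y != t.
  by have [y [? ? ? _]] := fourth b; exists y.
have bC : b \notin coatoms r.
  rewrite coatomE; apply/negP=> /and3P[_ _ /forallP/(_ y0)].
  by rewrite bP tP (negPf y0b) (negPf y0t).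
have tA : t \notin atoms r.
  rewrite atomE; apply/negP=> /and3P[_ _ /forallP/(_ y0)].
  by rewrite bP tP (negPf y0b) (negPf y0t).
have mid x : x != b -> x != t -> (x \in coatoms r) = (x \notin atoms r).
  move=> xb xt; apply/idP/idP => [xC|xA]; first by apply/negP=> /disj; apply.
  have [y [yb yx yt /orP[xy|yx']]] := fourth x.
    by rewrite eq_sym in yx; have [xA'] := step x y xy yx xb yt; rewrite xA' in xA.
  by have [] := step y x yx' yx yb xt.
have above x : x \in atoms r -> exists2 y, y \in coatoms r & r x y.
  move=> xA; have xb : x != b by apply: contraNneq bA => <-.
  have xt : x != t by apply: contraNneq tA => <-.
  have [y [yb yx yt /orP[xy|yx']]] := fourth x.
    by exists y => //; rewrite eq_sym in yx; have [] := step x y xy yx xb yt.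
  by have [_ /(disj _ xA)] := step y x yx' yx yb xt.
have below x : x \in coatoms r -> exists2 y, y \in atoms r & r y x.
  move=> xC; have xb : x != b by apply: contraNneq bC => <-.
  have xt : x != t by apply: contraNneq tC => <-.
  have [y [yb yx yt /orP[xy|yx']]] := fourth x.
    rewrite eq_sym in yx; have [/disj] := step x y xy yx xb yt; by case.
  by exists y => //; have [] := step y x yx' yx yb xt.
case/and4P: (rP) => /and3P[_ _ /forallP join] _ /eqP card_c /eqP card_a.
(* An arbitrary numbering of the coatoms; this choice is what the action of S_c later divides
   out. *)
pose co (i : 'I_c) := nth b (enum (coatoms r)) i.
have co_lt (i : 'I_c) : i < size (enum (coatoms r)) by rewrite -cardE card_c.
have coC i : co i \in coatoms r by rewrite -mem_enum mem_nth.
have co_inj : injective co.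
  by move=> i j /eqP; rewrite nth_uniq ?enum_uniq // => /eqP/val_inj.
have coK x : x \in coatoms r -> exists i, x = co i.
  rewrite -mem_enum => xC; have lt : index x (enum (coatoms r)) < c.
    by rewrite -card_c cardE index_mem.
  by exists (Ordinal lt); rewrite /co nth_index.
pose lab x : nat * {set 'I_c} :=
  if x == b then (0, setT) else if x \in atoms r then (1, [set i | r x (co i)])
  else if x \in coatoms r then (2, [set i | x == co i]) else (3, set0).
have labb : lab b = (0, setT) by rewrite /lab eqxx.
have labt : lab t = (3, set0).
  by rewrite /lab eq_sym (negPf bNt) (negPf tA) (negPf tC).
have labA x : x \in atoms r -> lab x = (1, [set i | r x (co i)]).
  by move=> xA; rewrite /lab xA; case: eqP => // E; rewrite -E xA in bA.
have labC x i : x = co i -> lab x = (2, [set i]).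
  move=> xi; have xC : x \in coatoms r by rewrite xi.
  rewrite /lab xC; case: eqP => [E|_]; first by rewrite -E xC in bC.
  case: ifP => [/disj/(_ xC)//|_]; congr pair; apply/setP=> j; rewrite !inE xi eq_sym.
  by rewrite (inj_eq co_inj).
have cases x : [\/ x = b, x \in atoms r, exists i, x = co i | x = t].
  have [->|xb] := eqVneq x b; first exact: Or41.
  have [->|xt] := eqVneq x t; first exact: Or44.
  have [xA|xA] := boolP (x \in atoms r); first exact: Or42.
  by apply/Or43/coK; rewrite mid.
have lev1 x : (lab x).1 = 1 -> x \in atoms r.
  by case: (cases x) => [->|//|[i /labC->]|->] //; rewrite ?labb ?labt.
have lev2 x : (lab x).1 = 2 -> exists i, x = co i.
  by case: (cases x) => [->|/labA->|//|->] //; rewrite ?labb ?labt.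
exists lab.
  split.
  - exists b; split=> // x.
    by case: (cases x) => [->|/labA->|[i /labC->]|->] //; rewrite labt.
  - exists t; split=> // x.
    by case: (cases x) => [->|/labA->|[i /labC->]|->] //; rewrite labb.
  - by move=> x; case: (cases x) => [->|/labA->|[i /labC->]|->] //; rewrite ?labb ?labt.
  - by move=> i; exists (co i); exact: labC.
  - by move=> x /lev2[i xi]; exists i; exact: labC.
  - move=> x y lx E; have [|i xi] := lev2 x; first by [].
    have [|j yj] := lev2 y; first by rewrite -E.
    by move: E; rewrite xi yj (labC _ i) // (labC _ j) // => -[] /set1_inj->.
  - move=> x /lev1 xA; rewrite labA //=; apply/set0Pn.
    by have [y /coK[i ->] xy] := above x xA; exists i; rewrite inE.
  - move=> x y /lev1 xA /lev1 yA xNy; rewrite !labA //= leqNgt; apply/negP.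
    case/card_gt1P=> i [j []]; rewrite !inE => /andP[xi yi] /andP[xj yj] ij.
    (* The join z of two distinct atoms lies strictly above one of them and below both coatoms,
       hence is a coatom equal to each of the two. *)
    have /existsP[z /and3P[xz yz /forallP zmin]] := forallP (join x) y.
    have zi : r z (co i) by have := zmin (co i); rewrite xi yi.
    have zj : r z (co j) by have := zmin (co j); rewrite xj yj.
    have Nt k : co k != t by apply: contraNneq tC => <-.
    have zt : z != t.
      by apply: contraNneq (Nt i) => E; rewrite E in zi; rewrite (tE _ zi).
    have xb : x != b by apply: contraNneq bA => <-.
    have yb : y != b by apply: contraNneq bA => <-.
    have xt : x != t by apply: contraNneq tA => <-.
    have xNz : x != z.
      apply/negP=> /eqP E; rewrite -E in yz; rewrite eq_sym in xNy.
      by have [_ /(disj _ xA)] := step y x yz xNy yb xt.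
    have [_ zC] := step x z xz xNz xb zt.
    have zb : z != b by apply: contraNneq bC => <-.
    have zE k : r z (co k) -> z = co k.
      move=> zk; apply/eqP; apply: contraT => zNk.
      by have [/disj] := step z (co k) zk zNk zb (Nt k); case.
    by move: ij; rewrite -(inj_eq co_inj) -(zE i zi) -(zE j zj) eqxx.
  - move=> i; have [y yA yi] := below (co i) (coC i).
    by exists y; rewrite labA // inE.
  rewrite -card_a; apply: eq_card => x; rewrite in_set.
  by apply/eqP/idP => [/lev1|/labA->].
move=> x y; rewrite /lab_rel; case: (eqVneq x y) => [->|xNy] /=; first exact: rr.
case: (cases x) => [xb|xA|[i xi]|xt].
- rewrite xb bP labb subsetT andbT; case: (cases y) => [yb|/labA->|[j /labC->]|->] //.
    by rewrite xb yb eqxx in xNy.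
  by rewrite labt.
- case: (cases y) => [yb|yA|[j yj]|yt].
  + rewrite yb labb ltn0; apply/negP=> /bE xb; by rewrite -xb xA in bA.
  + rewrite !labA // ltnn /=; apply/negP=> xy.
    have yt : y != t by apply: contraNneq tA => <-.
    have xb : x != b by apply: contraNneq bA => <-.
    by have [_ /(disj _ yA)] := step x y xy xNy xb yt.
  + by rewrite labA // (labC y j) // sub1set inE -yj.
  + by rewrite yt tP labt labA // sub0set.
- rewrite (labC x i) //; case: (cases y) => [yb|yA|[j yj]|yt].
  + rewrite yb labb ltn0; apply/negP=> /bE xb; by rewrite -xb xi coC in bC.
  + rewrite labA //; apply/negP=> xy.
    have yt : y != t by apply: contraNneq tA => <-.
    have xb : x != b by apply: contraNneq bC => <-; rewrite xi.
    by have [/disj xC] := step x y xy xNy xb yt; case: xC; rewrite xi.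
  + rewrite (labC y j) //; apply/negP=> xy.
    have yt : y != t by apply: contraNneq tC => <-; rewrite yj.
    have xb : x != b by apply: contraNneq bC => <-; rewrite xi.
    by have [/disj xC] := step x y xy xNy xb yt; case: xC; rewrite xi.
  + by rewrite yt tP labt sub0set.
rewrite xt labt; have -> : r t y = false.
  by apply/negP=> /tE yt; rewrite xt yt eqxx in xNy.
by case: (cases y) => [->|/labA->|[j /labC->]|->]; rewrite ?labb ?labt.
Qed.

End Rank3Structure.

(** * Multiplicities of the labels *)

(** Equal fibre sizes make the lists of values rearrangements of each other, and the rearrangement
    acts on the enumeration of [T]. *)
Lemma fiber_perm (T : finType) (L : eqType) (l1 l2 : T -> L) :
    (forall z, #|[set x | l1 x == z]| = #|[set x | l2 x == z]|) ->
  exists f : {perm T}, forall x, l2 (f x) = l1 x.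
Proof.
move=> eq12.
have cnt l z : count_mem z (codom l) = #|[set x : T | l x == z :> L]|.
  rewrite codomE count_map -sum1_count big_enum_cond /= -sum1_card.
  by apply: eq_bigl => x; rewrite inE.
have /tuple_permP[p pE] : perm_eq (codom_tuple l1) (codom_tuple l2).
  by apply/allP=> z _ /=; rewrite !cnt eq12.
pose f x := enum_val (p (enum_rank x)).
have f_inj : injective f by move=> x y /enum_val_inj/perm_inj/enum_rank_inj.
exists (perm f_inj) => x; rewrite permE /f.
have tnthE l i : tnth (codom_tuple l) i = l (enum_val i).
  by rewrite (tnth_nth (l (enum_val i))) /= codomE (nth_map (enum_val i)) -?enum_val_nth // -cardE.
have : tnth (codom_tuple l1) (enum_rank x) = tnth (codom_tuple l2) (p (enum_rank x)).
  rewrite [in LHS](tnth_nth (l1 x)) [X in nth _ X]pE -tnth_nth.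
  by rewrite tnth_mktuple.
by rewrite !tnthE enum_rankK.
Qed.

(** Pulling classes back along [g] is a bijection as soon as [g] meets every class. This trades
    classes of orders for classes of configurations. *)
Lemma card_equivalence_partition (T U : finType) (R : rel T) (Q : rel U)
    (D : {set T}) (E : {set U}) (g : U -> T) :
    equivalence_rel R ->
    {in E, forall u, g u \in D} -> {in E &, forall u v, R (g u) (g v) = Q u v} ->
    {in D, forall x, exists2 u, u \in E & R x (g u)} ->
  #|equivalence_partition R D| = #|equivalence_partition Q E|.
Proof.
move=> /equivalence_relP[Rr Rl] gD gR gS.
have Rsym x y : R x y = R y x by apply/idP/idP => /[dup] /Rl h1 h2; rewrite -h1 Rr.
pose psi (B : {set T}) := [set u in E | g u \in B].
have psiE x u : x \in D -> u \in E -> R x (g u) ->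
    psi [set y in D | R x y] = [set v in E | Q u v].
  move=> xD uE xu; apply/setP=> v; rewrite !inE; case: (boolP (v \in E)) => //= vE.
  by rewrite gD //= (Rl _ _ xu) gR.
have inj : {in equivalence_partition R D &, injective psi}.
  move=> B1 B2 /imsetP[x1 x1D ->] /imsetP[x2 x2D ->] E12.
  have [u uE xu] := gS x1 x1D.
  have : u \in psi [set y in D | R x1 y] by rewrite !inE uE gD.
  rewrite E12 !inE uE gD //= => x2u.
  by apply/setP=> y; rewrite !inE (Rl _ _ xu) (Rl _ _ x2u).
rewrite -(card_in_imset inj); congr #|pred_of_set _|; apply/setP=> B.
apply/imsetP/imsetP => [[_ /imsetP[x xD ->] ->]|[u uE ->]].
  by have [u uE xu] := gS x xD; exists u => //; exact: psiE.
exists [set y in D | R (g u) y]; first by apply: imset_f; exact: gD.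
by rewrite (psiE _ u) ?gD ?Rr.
Qed.

Section Multiplicities.

Variable c : nat.
Implicit Types (m : {set 'I_c} -> nat) (S : {set 'I_c}).

(** The trace of a labelling on its atom counts: [adm_once] is [lab_atomI] for two atoms with the
    same set, [adm_linear] for two with different sets. *)
Record admissible (a : nat) m : Prop := Admissible {
  adm0 : m set0 = 0;
  adm_once : forall S, 1 < m S -> #|S| <= 1;
  adm_linear : forall S S', S != S' -> 0 < m S -> 0 < m S' -> #|S :&: S'| <= 1;
  adm_cover : forall i, exists2 S : {set 'I_c}, i \in S & 0 < m S;
  adm_sum : \sum_S m S = a
}.

(** All fibre sizes of a labelling, prescribed by its atom multiplicities alone; this is the form in
    which [fiber_perm] applies. *)
Definition cell_count m (z : nat * {set 'I_c}) : nat :=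
  match z.1 with
  | 0 => z.2 == setT
  | 1 => m z.2
  | 2 => #|z.2| == 1
  | 3 => z.2 == set0
  | _ => 0
  end.

Variable T : finType.
Implicit Types lab : T -> nat * {set 'I_c}.

Definition lab_mult lab S := #|[set x | lab x == (1, S)]|.

Lemma labelling_admissible a lab : labelling a lab -> admissible a (lab_mult lab).
Proof.
move=> labP.
have pos S : 0 < lab_mult lab S -> exists x, lab x = (1, S).
  by case/card_gt0P=> x; rewrite inE => /eqP xS; exists x.
split.
- apply/eqP; rewrite -leqn0 leqNgt; apply/negP=> /pos[x xE].
  have /(lab_atom0 labP) : (lab x).1 = 1 by rewrite xE.
  by rewrite xE eqxx.
- move=> S /card_gt1P[x [y []]]; rewrite !inE => /eqP xS /eqP yS xNy.
  by have := lab_atomI labP _ _ xNy; rewrite xS yS setIid; apply.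
- move=> S S' SN /pos[x xS] /pos[y yS].
  have xNy : x != y by apply: contraNneq SN => E; move: xS; rewrite E yS => -[->].
  by have := lab_atomI labP _ _ xNy; rewrite xS yS; apply.
- move=> i; have [x [lx ix]] := lab_cover labP i; exists (lab x).2 => //.
  apply/card_gt0P; exists x; rewrite inE -lx; apply/eqP; exact: surjective_pairing.
- rewrite -(lab_card labP) -sum1_card (partition_big (fun x => (lab x).2) predT) //=.
  apply: eq_bigr => S _; rewrite /lab_mult -sum1_card; apply: eq_bigl => x.
  by rewrite !inE; case: (lab x).
Qed.

Lemma labelling_count a lab z : labelling a lab ->
  #|[set x | lab x == z]| = cell_count (lab_mult lab) z.
Proof.
case: z => l S labP; rewrite /cell_count /=.
have none : (forall x, lab x <> (l, S)) -> #|[set x | lab x == (l, S)]| = 0.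
  by move=> h; apply/eqP; rewrite cards_eq0; apply/eqP/setP=> x; rewrite !inE; apply/eqP.
have one y : lab y = (l, S) -> (forall x, lab x = (l, S) -> x = y) ->
    #|[set x | lab x == (l, S)]| = 1.
  move=> yE y1; apply/eqP/cards1P; exists y; apply/setP=> x; rewrite !inE.
  by apply/eqP/eqP => [/y1|->].
case: l none one => [|[|[|[|l]]]] none one.
- have [b [bE b1]] := lab_bottom labP; case: eqP => [E|E].
    by apply: (one b) => [|x xE]; rewrite ?E //; apply: b1; rewrite xE.
  by apply: none => x xE; case: E; have := b1 x; rewrite xE => /(_ erefl) E;
    rewrite E bE in xE; case: xE.
- by [].
- case: eqP => [/eqP/cards1P[i SE]|E].
    have [y yE] := lab_coatom labP i; rewrite -SE in yE.
    by apply: (one y) => [//|x xE]; apply: (lab_coatom_inj labP); rewrite xE.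
  apply: none => x xE; have [|i] := lab_coatom1 labP (x := x); first by rewrite xE.
  by rewrite xE => -[SE]; case: E; rewrite SE cards1.
- have [b [bE b1]] := lab_top labP; case: eqP => [E|E].
    by apply: (one b) => [|x xE]; rewrite ?E //; apply: b1; rewrite xE.
  by apply: none => x xE; case: E; have := b1 x; rewrite xE => /(_ erefl) E;
    rewrite E bE in xE; case: xE.
- by apply: none => x xE; have := lab_le3 labP x; rewrite xE.
Qed.

(** Fibre sizes carry every condition on a labelling: a nonempty fibre yields existence, a fibre
    with at most one element yields uniqueness. *)
Lemma count_labelling a m lab : admissible a m ->
    (forall z, #|[set x | lab x == z]| = cell_count m z) ->
  labelling a lab /\ lab_mult lab =1 m.
Proof.
move=> mP cnt.
have multE : lab_mult lab =1 m by move=> S; exact: cnt.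
split=> //.
have pos z : 0 < cell_count m z -> exists x, lab x = z.
  by rewrite -cnt => /card_gt0P[x]; rewrite inE => /eqP xz; exists x.
have posx x : 0 < cell_count m (lab x).
  by rewrite -cnt; apply/card_gt0P; exists x; rewrite inE.
have uniq x y : lab x = lab y -> cell_count m (lab x) <= 1 -> x = y.
  by move=> E; rewrite -cnt => /card_le1_eqP; apply; rewrite inE ?E.
split.
- have [|b bE] := pos (0, setT); first by rewrite /cell_count /= eqxx.
  exists b; split=> // x lx; have := posx x; have := @uniq x b.
  rewrite bE; case: (lab x) lx => l S /= ->; rewrite /cell_count /= lt0b => h /eqP SE.
  by apply: h; rewrite SE // leq_b1.
- have [|b bE] := pos (3, set0); first by rewrite /cell_count /= eqxx.
  exists b; split=> // x lx; have := posx x; have := @uniq x b.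
  rewrite bE; case: (lab x) lx => l S /= ->; rewrite /cell_count /= lt0b => h /eqP SE.
  by apply: h; rewrite SE // leq_b1.
- by move=> x; have := posx x; case: (lab x) => [[|[|[|[|]]]] S].
- by move=> i; apply: pos; rewrite /cell_count /= cards1.
- move=> x lx; have := posx x; case: (lab x) lx => l S /= ->.
  by rewrite /cell_count /= lt0b => /cards1P[i ->]; exists i.
- by move=> x y lx E; apply: uniq => //; rewrite /cell_count lx leq_b1.
- move=> x lx; apply: contraTneq (posx x) => E.
  by rewrite /cell_count lx E (adm0 mP).
- move=> x y lx ly xNy.
  have mpos z : (lab z).1 = 1 -> 0 < m (lab z).2.
    by move=> lz; have := posx z; rewrite /cell_count lz.
  have [E|/(adm_linear mP)] := eqVneq (lab x).2 (lab y).2; last by apply; exact: mpos.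
  rewrite -E setIid; apply: (adm_once mP); rewrite -multE.
  apply/card_gt1P; exists x, y; split; rewrite // inE [lab _]surjective_pairing.
    by rewrite lx.
  by rewrite ly E.
- move=> i; have [S iS mS] := adm_cover mP i.
  have [|x xE] := pos (1, S); first by [].
  by exists x; rewrite xE.
rewrite -(adm_sum mP) -sum1_card (partition_big (fun x => (lab x).2) predT) //=.
apply: eq_bigr => S _; rewrite -multE /lab_mult -sum1_card; apply: eq_bigl => x.
by rewrite !inE; case: (lab x).
Qed.

(** All required labels are listed with repetition; the list has as many entries as [T] has
    elements, so it is distributed along the enumeration of [T]. *)
Lemma count_exists a m : admissible a m -> #|T| = (c + a).+2 ->
  exists lab, forall z, #|[set x | lab x == z]| = cell_count m z.
Proof.
move=> mP cardT.
pose coats : seq (nat * {set 'I_c}) := [seq (2, [set i]) | i <- enum 'I_c].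
pose atms := [seq (1, A) | A <- flatten [seq nseq (m A) A | A <- enum {set 'I_c}]].
pose s := [:: (0, setT), (3, set0) & coats ++ atms].
have size_s : size s = #|T|.
  rewrite /= size_cat [size coats]size_map [size atms]size_map size_flatten /shape -map_comp.
  rewrite cardT -(adm_sum mP) size_enum_ord sumnE big_map big_enum /=.
  by congr (_ + _).+2; apply: eq_bigr => S _; rewrite size_nseq.
have count_coats l S : count_mem (l, S) coats = (l == 2) && (#|S| == 1).
  rewrite count_map -sum1_count big_enum_cond /=; case: eqP => [->|l2] /=; last first.
    by rewrite big_pred0 // => i; apply/eqP=> -[E]; case: l2.
  case: eqP => [/eqP/cards1P[i ->]|S1]; last first.
    by rewrite big_pred0 // => i; apply/eqP=> -[E]; case: S1; rewrite -E cards1.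
  by rewrite (big_pred1 i) // => j; rewrite /= xpair_eqE eqxx (inj_eq set1_inj).
have count_atms l S : count_mem (l, S) atms = (l == 1) * m S.
  rewrite count_map count_flatten -map_comp sumnE big_map big_enum /=.
  rewrite (bigD1 S) //= count_nseq /= xpair_eqE eqxx andbT eq_sym.
  rewrite big1 ?addn0 // => S' SN; rewrite count_nseq /= xpair_eqE (negPf SN) andbF.
  exact: mul0n.
pose lab (x : T) := nth (0, setT) s (enum_rank x).
exists lab => z.
have -> : #|[set x | lab x == z]| = count_mem z s.
  rewrite -sum1_count (big_nth (0, setT)) big_mkord size_s -sum1_card.
  rewrite (reindex (@enum_rank T)) /=; last first.
    by exists enum_val => x _; rewrite ?enum_rankK ?enum_valK.
  by apply: eq_bigl => x; rewrite inE.
case: z => l S; rewrite /= count_cat count_coats count_atms !xpair_eqE /cell_count /=.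
by case: l => [|[|[|[|l]]]]; rewrite /= ?[_ == S]eq_sym ?mul1n ?addn0.
Qed.

End Multiplicities.

(** * Configurations and their isomorphisms *)

Section Configurations.

Variables c a : nat.

Definition linear_hyp (h : {set {set 'I_c}}) : bool :=
  [forall S in h, 1 < #|S|] &&
  [forall S in h, forall S' in h, (S != S') ==> (#|S :&: S'| <= 1)].

(* #|h| edges plus one forced singleton for each uncovered coatom. *)
Definition weight (h : {set {set 'I_c}}) : nat := #|h| + #|~: cover h|.

(** The bound [a] on multiplicities keeps the type finite and loses nothing, since in a valid
    configuration they sum to at most [a]. *)
Definition conf : finType := ({set {set 'I_c}} * {ffun 'I_c -> 'I_a.+1})%type.
Implicit Types (p q : conf) (s : 'S_c) (S : {set 'I_c}).

Definition valid : {set conf} :=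
  [set p : conf | linear_hyp p.1 && (\sum_i p.2 i + weight p.1 == a)].

(* p.2 i counts the singletons {i} in excess of the forced one. *)
Definition mult p S : nat :=
  (S \in p.1) + \sum_i (S == [set i]) * (p.2 i + (i \notin cover p.1)).

Lemma mult_edge p S : #|S| != 1 -> mult p S = (S \in p.1).
Proof.
move=> S1; rewrite /mult big1 ?addn0 // => i _.
by case: eqP => // E; rewrite E cards1 in S1.
Qed.

Lemma mult_set1 p i : linear_hyp p.1 -> mult p [set i] = p.2 i + (i \notin cover p.1).
Proof.
case/andP=> /forall_inP h1 _.
have -> : mult p [set i] = ([set i] \in p.1) + (p.2 i + (i \notin cover p.1)).
  congr (_ + _); rewrite (bigD1 i) //= eqxx mul1n big1 ?addn0 // => j ji.
  by rewrite (inj_eq set1_inj) eq_sym (negPf ji).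
by case: (boolP ([set i] \in p.1)) => // /h1; rewrite cards1.
Qed.

Lemma sum_mult p : \sum_S mult p S = \sum_i p.2 i + weight p.1.
Proof.
rewrite big_split /= exchange_big /= -big_mkcond sum1_card.
rewrite [X in _ + X](eq_bigr (fun i : 'I_c => p.2 i + (i \notin cover p.1))) => [|i _].
  rewrite big_split /= addnCA; congr (_ + (_ + _)).
  by rewrite -big_mkcond sum1_card; apply: eq_card => i; rewrite inE.
rewrite (bigD1 [set i]) //= eqxx mul1n big1 ?addn0 // => S Si.
by rewrite (negPf Si).
Qed.

Lemma mult_admissible p : p \in valid -> admissible a (mult p).
Proof.
rewrite inE => /andP[lin /eqP suma].
have [/forall_inP h1 /forall_inP h2] := andP lin.
have h0 : set0 \notin p.1 by apply/negP=> /h1; rewrite cards0.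
split.
- by rewrite mult_edge ?cards0 // (negPf h0).
- move=> S mS; rewrite leqNgt; apply: contraTN mS => S2.
  by rewrite mult_edge ?gtn_eqF // -leqNgt leq_b1.
- move=> S S' SN; have [S1 _ _|S1] := leqP #|S| 1.
    exact: leq_trans (subset_leq_card (subsetIl _ _)) S1.
  rewrite mult_edge ?gtn_eqF // lt0b => Sh.
  have [S'1 _|S'1] := leqP #|S'| 1.
    exact: leq_trans (subset_leq_card (subsetIr _ _)) S'1.
  rewrite mult_edge ?gtn_eqF // lt0b => S'h.
  by have /forall_inP/(_ _ S'h) := h2 S Sh; rewrite SN.
- move=> i; have [/bigcupP[S Sh iS]|ci] := boolP (i \in cover p.1).
    by exists S => //; rewrite mult_edge ?Sh // gtn_eqF // h1.
  by exists [set i]; rewrite ?set11 // mult_set1 // ci addn1.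
- by rewrite sum_mult.
Qed.

Lemma mult_inj p q : p \in valid -> q \in valid -> mult p =1 mult q -> p = q.
Proof.
rewrite !inE => /andP[lp _] /andP[lq _] E.
have hE : p.1 = q.1.
  apply/setP=> S; have [S1|S1] := eqVneq #|S| 1; last first.
    by have := E S; rewrite !mult_edge //; do 2 case: (_ \in _).
  have N r : linear_hyp r -> (S \in r) = false.
    by case/andP=> /forall_inP h _; apply/negP=> /h; rewrite S1.
  by rewrite !N.
case: p q hE lp lq E => [h n] [h' n'] /= <- lp lq E; congr pair.
apply/ffunP=> i; apply/val_inj; have := E [set i].
by rewrite !mult_set1 //= => /addIn.
Qed.

Lemma mult_surj m : admissible a m -> exists2 p, p \in valid & mult p =1 m.
Proof.
move=> mP; pose h := [set S : {set 'I_c} | (1 < #|S|) && (0 < m S)].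
have m_le S : m S <= a by rewrite -(adm_sum mP) (bigD1 S) //= leq_addr.
have lin : linear_hyp h.
  apply/andP; split; first by apply/forall_inP=> S; rewrite inE => /andP[].
  apply/forall_inP=> S; rewrite inE => /andP[_ mS]; apply/forall_inP=> S'.
  by rewrite inE => /andP[_ mS']; apply/implyP=> SN; exact: (adm_linear mP).
pose p : conf := (h, [ffun i => inord (m [set i] - (i \notin cover h))]).
have mE : mult p =1 m.
  move=> S; have [/eqP/cards1P[i ->]|S1] := eqVneq #|S| 1.
    rewrite mult_set1 //= ffunE inordK ?ltnS ?(leq_trans (leq_subr _ _)) //.
    (* The subtraction is exact: when no edge covers i, the set containing i provided by [adm_cover]
       can only be the singleton. *)
    rewrite subnK //; case: (boolP (i \in cover h)) => //= ci.
    have [S' iS' mS'] := adm_cover mP i.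
    suff -> : [set i] = S' by [].
    apply/eqP; rewrite eqEcard sub1set iS' cards1 leqNgt; apply: contra ci => S'2.
    by apply/bigcupP; exists S' => //; rewrite inE S'2.
  rewrite mult_edge // inE.
  case: (ltngtP #|S| 1) S1 => //= [|S2 _].
    by rewrite ltnS leqn0 cards_eq0 => /eqP -> _; rewrite (adm0 mP).
  by have := adm_once mP (S := S); case: (m S) => [|[|k]] //= /(_ isT); rewrite leqNgt S2.
exists p => //; rewrite inE lin -sum_mult /= -(adm_sum mP).
by apply/eqP; apply: eq_bigr => S _.
Qed.

(** The inverse moves the multiplicity at [i] to [s i], in step with the images of the edges. *)
Definition conf_act p s : conf :=
  ([set [set s i | i in S : {set 'I_c}] | S in p.1], [ffun i => p.2 ((s^-1)%g i)]).

Lemma conf_is_action : is_action [set: 'S_c] conf_act.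
Proof.
apply: is_total_action => [[h n]|[h n] s t]; congr pair.
- rewrite /= -[RHS]imset_id; apply: eq_imset => S.
  by rewrite -[RHS]imset_id; apply: eq_imset => i; rewrite perm1.
- by apply/ffunP=> i; rewrite ffunE invg1 perm1.
- rewrite /= -imset_comp; apply: eq_imset => S /=.
  by rewrite -imset_comp; apply: eq_imset => i; rewrite /= permM.
- by apply/ffunP=> i; rewrite !ffunE invMg permM.
Qed.

Canonical conf_action := Action conf_is_action.

Lemma cover_act p s i : (s i \in cover (conf_act p s).1) = (i \in cover p.1).
Proof.
apply/bigcupP/bigcupP => [[_ /imsetP[S Sh ->] ]|[S Sh iS]].
  by rewrite (mem_imset _ _ (@perm_inj _ s)) => iS; exists S.
by exists (s @: S); apply: imset_f.
Qed.

Lemma imset_perm_inj s : injective (fun S : {set 'I_c} => s @: S).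
Proof. exact/imset_inj/perm_inj. Qed.

Lemma mult_act p s S : mult (conf_act p s) (s @: S) = mult p S.
Proof.
rewrite /mult (mem_imset _ _ (@imset_perm_inj s)); congr (_ + _).
rewrite (reindex_inj (@perm_inj _ s)) /=; apply: eq_bigr => i _.
rewrite ffunE permK cover_act -imset_set1; congr (nat_of_bool _ * _).
exact: inj_eq (@imset_perm_inj s) _ _.
Qed.

Lemma valid_act p s : p \in valid -> conf_act p s \in valid.
Proof.
rewrite !inE -!sum_mult => /andP[/andP[/forall_inP h1 /forall_inP h2] suma].
apply/andP; split; last first.
  rewrite (reindex_inj (@imset_perm_inj s)) /=.
  by under eq_bigr do rewrite mult_act.
apply/andP; split.
  apply/forall_inP=> _ /imsetP[S Sh ->].
  by rewrite card_imset ?h1 //; exact: perm_inj.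
apply/forall_inP=> _ /imsetP[S Sh ->]; apply/forall_inP=> _ /imsetP[S' S'h ->].
rewrite (inj_eq (@imset_perm_inj s)) -imsetI; last by move=> ? ? _ _; exact: perm_inj.
by rewrite card_imset; [exact: (forall_inP (h2 S Sh))|exact: perm_inj].
Qed.

(** * Isomorphic orders and orbits of configurations *)

Section Realizations.

Variable T : finType.
Hypothesis c_gt0 : 0 < c.
Implicit Types lab : T -> nat * {set 'I_c}.

Definition realizes lab p := forall z, #|[set x | lab x == z]| = cell_count (mult p) z.

Lemma realizes_relabel lab p s : realizes lab p ->
  realizes (fun x => ((lab x).1, s @: (lab x).2)) (conf_act p s).
Proof.
move=> labp [l S]; have -> : S = s @: ((s^-1)%g @: S).
  by rewrite -imset_comp -[LHS]imset_id; apply: eq_imset => i; rewrite /= permKV.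
set S' := _ @: S.
have -> : #|[set x | ((lab x).1, s @: (lab x).2) == (l, s @: S')]| =
    #|[set x | lab x == (l, S')]|.
  apply: eq_card => x; rewrite !inE !xpair_eqE (inj_eq (@imset_perm_inj s)).
  by case: (lab x).
rewrite labp /cell_count /= mult_act [#|s @: S'|]card_imset; last exact: perm_inj.
have T0 : s @: setT = setT.
  by apply/setP=> i; rewrite inE -[i](permKV s) mem_imset ?inE //; exact: perm_inj.
have -> : (s @: S' == setT) = (S' == setT).
  by rewrite -{1}T0 (inj_eq (@imset_perm_inj s)).
have -> : (s @: S' == set0) = (S' == set0).
  by rewrite -{1}(imset0 s) (inj_eq (@imset_perm_inj s)).
by [].
Qed.

(** An order isomorphism [f] turns [lab' \o f] into a second labelling of the order of [lab], and
    [labelling_unique] yields [s]. Conversely, relabelling by [s] equalizes the fibre sizes, and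
    [fiber_perm] yields [f]. *)
Lemma realizes_iso lab lab' p q : p \in valid -> q \in valid ->
    realizes lab p -> realizes lab' q ->
  (exists f : {perm T}, forall x y, lab_rel lab x y = lab_rel lab' (f x) (f y)) <->
  (exists s, q = conf_act p s).
Proof.
move=> pV qV labp labq; split=> [[f fE]|[s qE]]; last first.
  have [f fE] : exists f : {perm T}, forall x, lab' (f x) = ((lab x).1, s @: (lab x).2).
    by apply: fiber_perm => z; rewrite labq qE; exact: realizes_relabel.
  exists f => x y; rewrite /lab_rel (inj_eq perm_inj) !fE /=; congr (_ || _ && _).
  apply/idP/idP => [|/subsetP sub]; first exact: imsetS.
  by apply/subsetP=> i iy; have := sub (s i); rewrite !mem_imset; auto; exact: perm_inj.
have labq' : realizes (lab' \o f) q.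
  move=> z; rewrite -labq -(card_imset _ (@perm_inj _ f)); apply: eq_card => x.
  by rewrite -[x](permKV f) mem_imset ?inE //; exact: perm_inj.
have [lP _] := count_labelling (mult_admissible pV) labp.
have [lP' _] := count_labelling (mult_admissible qV) labq'.
have [|s sE] := labelling_unique c_gt0 lP lP'.
  by move=> x y; rewrite fE /lab_rel (inj_eq perm_inj).
exists s; apply: mult_inj => //; first exact: valid_act.
move=> S; rewrite -[LHS](labq' (1, S)) -[RHS](realizes_relabel s labp (1, S)).
by apply: eq_card => x; rewrite !inE sE.
Qed.

End Realizations.

Lemma R_orbits : 0 < c -> R c a = #|orbit conf_action [set: 'S_c] @: valid|.
Proof.
move=> c_gt0; pose T := 'I_(c + a).+2.
(* Chooses an order realizing each valid configuration; invalid ones receive the arbitrary value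
   [set0]. *)
have /fin_all_exists[g gP] (p : conf) : exists G : {set T * T}, p \in valid ->
    exists2 lab, realizes lab p & graph_rel G = lab_rel lab.
  case: (boolP (p \in valid)) => [pV|_]; last by exists set0.
  have [|lab labp] := @count_exists c T _ _ (mult_admissible pV).
    by rewrite card_ord.
  exists [set xy | lab_rel lab xy.1 xy.2] => _; exists lab => //.
  apply: functional_extensionality => x; apply: functional_extensionality => y.
  by rewrite /graph_rel inE.
rewrite /R (@card_equivalence_partition _ _ _
  (fun p q : conf => q \in orbit conf_action [set: 'S_c] p) _ valid g).
- congr #|pred_of_set _|; apply: eq_in_imset => p pV; apply/setP=> q; rewrite inE.
  case: (boolP (q \in orbit _ _ _)) => [|_]; last by rewrite andbF.
  by case/orbitP=> s _ <-; rewrite andbT; exact: valid_act.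
- exact: order_iso_equiv.
- move=> p pV; have [lab labp gE] := gP p pV; rewrite inE gE.
  apply: lab_rel_rank3 => //.
  by have [] := count_labelling (mult_admissible pV) labp.
- move=> p q pV qV; have [lab labp gp] := gP p pV; have [lab' labq gq] := gP q qV.
  have iso := realizes_iso c_gt0 pV qV labp labq.
  apply/order_isoP/orbitP; rewrite gp gq.
    by move/iso => [s ->]; exists s; rewrite ?inE.
  by case=> s _ /esym qE; apply/iso; exists s.
- move=> G; rewrite inE => /rank3_labelling[] // lab labP rE.
  have [p pV pE] := mult_surj (labelling_admissible labP).
  exists p => //; have [lab' labp gE] := gP p pV.
  have [f fE] : exists f : {perm T}, forall x, lab' (f x) = lab x.
    apply: fiber_perm => z; rewrite (labelling_count z labP) labp /cell_count.
    by rewrite pE.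
  apply/order_isoP; exists f => x y.
  by rewrite rE gE /lab_rel !fE (inj_eq perm_inj).
Qed.

End Configurations.

(** * Burnside's lemma *)

Section Fixpoints.

Variables c a : nat.
Implicit Types (g s : 'S_c) (h : {set {set 'I_c}}).

(** Preimages are used because membership in them only evaluates [g], which [inv_seq] can imitate on
    lists. *)
Definition inv_hyp g h : bool := [forall S in h, (g @^-1: S) \in h].

(** The hypergraph enters only through its weight [k], so hypergraphs of equal weight can be
    grouped. *)
Definition inv_count g k : nat :=
  #|[set n : {ffun 'I_c -> 'I_a.+1}
      | [forall i, n (g i) == n i] && (\sum_i n i + k == a)]|.

Definition fix_count g : nat :=
  \sum_(h | linear_hyp h && inv_hyp g h) inv_count g (weight h).

(** An injection of a finite set into itself is onto, so closure under preimages already gives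
    invariance. *)
Lemma inv_hypP g h : reflect ([set g @: (S : {set 'I_c}) | S in h] = h) (inv_hyp g h).
Proof.
have gK (S : {set 'I_c}) : g @^-1: (g @: S) = S.
  by apply/setP=> i; rewrite inE mem_imset //; exact: perm_inj.
have gKV (S : {set 'I_c}) : g @: (g @^-1: S) = S.
  by apply/setP=> i; rewrite -[i](permKV g) mem_imset ?inE //; exact: perm_inj.
apply: (iffP forall_inP) => [hP|hE S].
  have inj : injective (fun S : {set 'I_c} => g @^-1: S) by move=> S S' E; rewrite -(gKV S) E gKV.
  have E : [set g @^-1: S | S : {set 'I_c} in h] = h.
    apply/eqP; rewrite eqEcard card_imset // leqnn andbT.
    by apply/subsetP=> _ /imsetP[S Sh ->]; exact: hP.
  by rewrite -{1}E -imset_comp -[RHS]imset_id; apply: eq_imset => S /=.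
by rewrite -{1}hE => /imsetP[S' S'h ->]; rewrite gK.
Qed.

Lemma card_fix g : #|'Fix_(valid c a | conf_action c a)[g]%g| = fix_count g.
Proof.
rewrite -sum1_card (partition_big (fun p : conf c a => p.1)
  (fun h => linear_hyp h && inv_hyp g h)) /=; last first.
  move=> p /setIP[]; rewrite inE => /andP[-> _] /afix1P/(congr1 fst) /= E.
  exact/inv_hypP.
apply: eq_bigr => h /andP[lin /inv_hypP inv]; rewrite sum1_card.
pose f (n : {ffun 'I_c -> 'I_a.+1}) : conf c a := (h, n).
rewrite /inv_count -(card_imset _ (_ : injective f)); last by move=> n n' [].
apply: eq_card => p; rewrite unfold_in /=; apply/andP/imsetP.
  case: p => h' n [/setIP[]]; rewrite inE => /andP[_ suma] /afix1P/(congr1 snd) /= nE.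
  move/eqP=> /= hE; rewrite /= hE in suma *; exists n => //.
  rewrite inE suma andbT; apply/forallP=> i.
  by rewrite -{1}nE ffunE permK.
case=> n; rewrite inE => /andP[/forallP nE suma] ->; split=> //=.
apply/setIP; split; first by rewrite inE lin suma.
apply/afix1P; rewrite /= /conf_act /= inv; congr pair.
by apply/ffunP=> i; rewrite ffunE -[in RHS](permKV g i) (eqP (nE _)).
Qed.

(** Acting by [u] injects the fixed points of [t] into those of [t ^ u]; the reverse inequality is
    the same fact for the inverse conjugation. *)
Lemma fix_count_conj g s : fix_count (g ^ s)%g = fix_count g.
Proof.
suff le t u : fix_count t <= fix_count (t ^ u)%g.
  by apply/eqP; rewrite eqn_leq le -{2}(conjgK s g) le.
rewrite -!card_fix -(card_imset _ (act_inj (conf_action c a) u)).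
apply/subset_leq_card/subsetP=> _ /imsetP[p /setIP[pV /afix1P pt] ->].
apply/setIP; split; first exact: valid_act.
by apply/afix1P; rewrite -!actM -conjgC actM pt.
Qed.

Lemma burnside : 0 < c -> R c a * c`! = \sum_(g : 'S_c) fix_count g.
Proof.
move=> c_gt0; rewrite R_orbits // -(card_Sn c) -cardsT.
rewrite -(Frobenius_Cauchy (to := conf_action c a)).
  by apply: eq_big => g; rewrite ?inE // card_fix.
apply/subsetP=> s _; rewrite !inE; apply/subsetP=> p pV; rewrite inE.
exact: valid_act.
Qed.

End Fixpoints.

(** * Enumeration of hypergraphs by lists *)

Section Sublists.

Variable X : eqType.

Fixpoint sublists (s : seq X) : seq (seq X) :=
  if s is x :: s' then [seq x :: l | l <- sublists s'] ++ sublists s' else [:: [::]].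

Lemma mem_sublists s l : (l \in sublists s) = subseq l s.
Proof.
elim: s l => [|x s IH] l /=; first by rewrite inE; case: l.
rewrite mem_cat IH; case: l => [|y l]; first by rewrite sub0seq orbT.
rewrite /=; case: eqP => [->|yx].
  rewrite mem_map ?IH => [|? ? []//].
  apply/orb_idr => /(subseq_trans _) -> //; exact: subseq_cons.
by case: mapP => [[l' _ []]|].
Qed.

Lemma sublists_uniq s : uniq s -> uniq (sublists s).
Proof.
elim: s => //= x s IH /andP[xs us]; rewrite cat_uniq map_inj_uniq => [|? ? []//].
rewrite IH // andbT /=; apply/hasPn=> l; rewrite mem_sublists => /mem_subseq ls.
by apply: contra xs => /mapP[l' _ E]; apply: ls; rewrite E inE eqxx.
Qed.

End Sublists.

Lemma map_sublists (X Y : eqType) (f : X -> Y) s :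
  sublists (map f s) = map (map f) (sublists s).
Proof.
elim: s => //= x s ->; rewrite map_cat -!map_comp; congr (_ ++ _).
Qed.

Lemma sum_sublists (X : finType) (s : seq X) (F : {set X} -> nat) : uniq s ->
  \sum_(h : {set X} | h \subset s) F h = \sum_(l <- sublists s) F [set x in l].
Proof.
elim: s F => [|x s IH] F /=.
  rewrite big_seq1 (big_pred1 set0) => [_|h /=]; last first.
    rewrite -subset0; apply/subsetP/subsetP => hs y /hs; by rewrite inE.
  by congr F; apply/setP=> y; rewrite !inE.
case/andP=> xs us; rewrite big_cat big_map /= (bigID (fun h : {set X} => x \in h)) /=.
have sub_cons (h : {set X}) : x \notin h -> (h \subset x :: s) = (h \subset s).
  move=> xh; apply/subsetP/subsetP => hs y yh; have := hs y yh; rewrite inE ?orbT.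
    by case: eqP => // E; rewrite -E yh in xh.
  by move=> ->; rewrite orbT.
have xNh (h : {set X}) : h \subset s -> x \notin h.
  by move=> hs; apply: contra xs => /(subsetP hs).
congr (_ + _); last first.
  rewrite -IH //; apply: eq_bigl => h; apply/andP/idP => [[hs xh]|hs].
    by rewrite -sub_cons.
  by rewrite sub_cons xNh.
rewrite (reindex_onto (fun h => x |: h) (fun h => h :\ x)) => [|h /andP[_ xh]]; last first.
  exact: setD1K.
rewrite (eq_bigl (fun h : {set X} => h \subset s)) => [|h].
  rewrite (IH (fun h => F (x |: h))) //; apply: eq_bigr => l _.
  by congr F; apply/setP=> y; rewrite !inE.
rewrite setU11 andbT; apply/andP/idP => [[sub /eqP hE]|hs].
  have xh : x \notin h by rewrite -hE !inE eqxx.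
  by rewrite -sub_cons //; apply: subset_trans sub; exact: subsetUr.
rewrite setU1K ?xNh // eqxx; split=> //.
by apply/subsetP=> y /setU1P[->|/(subsetP hs)]; rewrite inE ?eqxx // => ->; rewrite orbT.
Qed.

Section Encoding.

Variable c : nat.

Definition set_of_seq (b : seq nat) : {set 'I_c} := [set i : 'I_c | val i \in b].

Definition edges : seq (seq nat) := [seq b <- sublists (iota 0 c) | 1 < size b].

Lemma card_ord_count (P : pred nat) : #|[set i : 'I_c | P i]| = count P (iota 0 c).
Proof.
rewrite -val_enum_ord count_map -sum1_count big_enum_cond /= -sum1_card.
by apply: eq_bigl => i; rewrite inE.
Qed.

Definition lin_seq (l : seq (seq nat)) : bool :=
  all (fun b : seq nat => all (fun b' : seq nat => (b != b') ==>
    (count (fun i => (i \in b) && (i \in b')) (iota 0 c) <= 1)) l) l.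

Definition inv_seq (r : seq nat) (l : seq (seq nat)) : bool :=
  all (fun b : seq nat => [seq i <- iota 0 c | nth 0 r i \in b] \in l) l.

Definition weight_seq (l : seq (seq nat)) : nat :=
  size l + count (fun i => ~~ has (fun b : seq nat => i \in b) l) (iota 0 c).

(** A sublist of [iota 0 c] is that list filtered by membership, so its members determine it. *)
Lemma set_of_seq_inj : {in sublists (iota 0 c) &, injective set_of_seq}.
Proof.
move=> b b'; rewrite !mem_sublists => /(subseq_uniqP (iota_uniq 0 c)) bE.
move=> /(subseq_uniqP (iota_uniq 0 c)) bE' E; rewrite bE bE'.
apply: eq_in_filter => i; rewrite mem_iota add0n => /= ic.
by have := congr1 (fun A : {set 'I_c} => Ordinal ic \in A) E; rewrite !inE.
Qed.

Lemma filter_edges_sublists P : [seq i <- iota 0 c | P i] \in sublists (iota 0 c).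
Proof. by rewrite mem_sublists filter_subseq. Qed.

Lemma card_set_of_seq b : b \in sublists (iota 0 c) -> #|set_of_seq b| = size b.
Proof.
rewrite card_ord_count mem_sublists => /(subseq_uniqP (iota_uniq 0 c)) bE.
by rewrite -size_filter -bE.
Qed.

Lemma set_of_seq_surj (S : {set 'I_c}) :
  exists2 b, b \in sublists (iota 0 c) & S = set_of_seq b.
Proof.
exists [seq i <- iota 0 c | i \in map val (enum S)]; first exact: filter_edges_sublists.
apply/setP=> i; rewrite inE mem_filter mem_iota leq0n ltn_ord !andbT.
by rewrite (mem_map val_inj) mem_enum.
Qed.

(** The bridge from finite sets to computable data, with [r] the one-line notation of [g]. Leaving
    [F] arbitrary reduces the sum to a list of weights. *)
Lemma sum_hyp (g : 'S_c) (r : seq nat) (F : nat -> nat) :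
    (forall i : 'I_c, val (g i) = nth 0 r i) ->
  \sum_(h | linear_hyp h && inv_hyp g h) F (weight h) =
  \sum_(k <- [seq weight_seq l | l <- sublists edges & lin_seq l && inv_seq r l]) F k.
Proof.
move=> gr; pose E := map set_of_seq edges.
have edgesP b : b \in edges -> b \in sublists (iota 0 c) by rewrite mem_filter => /andP[].
have uE : uniq E.
  rewrite map_inj_in_uniq => [|b b' /edgesP ? /edgesP ?]; last exact: set_of_seq_inj.
  by apply/filter_uniq/sublists_uniq/iota_uniq.
have E2 (S : {set 'I_c}) : 1 < #|S| -> S \in E.
  have [b bs ->] := set_of_seq_surj S; rewrite card_set_of_seq // => b2.
  by apply: map_f; rewrite mem_filter b2.
(* The conditions move into the summand because [sum_sublists] runs over all subsets of a list. *)
transitivity (\sum_(h : {set {set 'I_c}} | h \subset E)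
    if linear_hyp h && inv_hyp g h then F (weight h) else 0).
  rewrite -big_mkcondr; apply: eq_bigl => h; symmetry; apply: andb_idl.
  case/andP=> /andP[/forall_inP h1 _] _; apply/subsetP=> S /h1; exact: E2.
rewrite sum_sublists // map_sublists big_map big_map big_filter [RHS]big_mkcond.
apply: eq_big_seq => l; rewrite mem_sublists => lE.
have ul : uniq l by apply: subseq_uniq lE _; exact/filter_uniq/sublists_uniq/iota_uniq.
have {}lE b : b \in l -> (b \in sublists (iota 0 c)) && (1 < size b).
  by move=> /(mem_subseq lE); rewrite mem_filter andbC.
set h := [set S in map set_of_seq l].
have memh b : b \in l -> set_of_seq b \in h by move=> bl; rewrite inE map_f.
have hP S : S \in h -> exists2 b, b \in l & S = set_of_seq b.
  by rewrite inE => /mapP.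
have linE : linear_hyp h = lin_seq l.
  have h1 : [forall S in h, 1 < #|S|].
    apply/forall_inP=> _ /hP[b /lE/andP[bs b2] ->].
    by rewrite card_set_of_seq.
  have capE b b' : #|set_of_seq b :&: set_of_seq b'| =
      count (fun i => (i \in b) && (i \in b')) (iota 0 c).
    by rewrite -card_ord_count; apply: eq_card => i; rewrite !inE.
  have neqE b b' : b \in l -> b' \in l ->
      (set_of_seq b != set_of_seq b') = (b != b').
    move=> /lE/andP[bs _] /lE/andP[b's _]; congr negb.
    by apply/eqP/eqP => [|-> //]; exact: set_of_seq_inj.
  rewrite /linear_hyp h1 /=; apply/forall_inP/allP => [h2 b bl|h2 _ /hP[b bl ->]].
    apply/allP=> b' b'l; rewrite -neqE // -capE.
    exact: (forall_inP (h2 _ (memh _ bl)) _ (memh _ b'l)).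
  apply/forall_inP=> _ /hP[b' b'l ->]; rewrite neqE // capE.
  exact: (allP (h2 _ bl)).
have invE : inv_hyp g h = inv_seq r l.
  have preE b : g @^-1: set_of_seq b = set_of_seq [seq i <- iota 0 c | nth 0 r i \in b].
    by apply/setP=> i; rewrite !inE mem_filter mem_iota leq0n ltn_ord !andbT /= -gr.
  apply/forall_inP/allP => [hi b bl|hi _ /hP[b bl ->]].
    have := hi _ (memh _ bl); rewrite preE => /hP[b' b'l bE].
    have /andP[b's _] := lE _ b'l.
    by rewrite (set_of_seq_inj _ b's bE) // filter_edges_sublists.
  by rewrite preE; apply: memh; exact: hi.
have weightE : weight h = weight_seq l.
  congr (_ + _).
    rewrite cardsE -(size_map set_of_seq); apply/card_uniqP.
    rewrite map_inj_in_uniq // => b b' /lE/andP[bs _] /lE/andP[b's _].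
    exact: set_of_seq_inj.
  rewrite -card_ord_count; apply: eq_card => i; rewrite !inE; congr negb.
  apply/bigcupP/hasP => [[_ /hP[b bl ->]]|[b bl ib]].
    by rewrite inE; exists b.
  by exists (set_of_seq b); rewrite ?memh // inE.
by rewrite -/h linE invE weightE.
Qed.

End Encoding.

(** * Cycle types in S_4 *)

Section OneLine.

Variable c : nat.
Implicit Types (g : 'S_c) (l r s : seq nat).

Definition one_line g : seq nat := [seq val (g i) | i <- enum 'I_c].

(* The identity when l is not the one-line notation of a permutation. *)
Definition perm_of l : 'S_c := odflt 1%g [pick g | one_line g == l].

Lemma nth_one_line g (i : 'I_c) : nth 0 (one_line g) i = g i.
Proof. by rewrite (nth_map i) ?size_enum_ord // nth_ord_enum. Qed.

Lemma one_line_inj : injective one_line.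
Proof.
by move=> g h E; apply/permP=> i; apply: val_inj; rewrite /= -!nth_one_line E.
Qed.

(** One inclusion suffices, both lists being duplicate-free with c! entries. *)
Lemma one_line_permutations :
  perm_eq [seq one_line g | g <- enum 'S_c] (permutations (iota 0 c)).
Proof.
have u : uniq [seq one_line g | g <- enum 'S_c].
  by rewrite map_inj_uniq ?enum_uniq //; exact: one_line_inj.
have sub : {subset [seq one_line g | g <- enum 'S_c] <= permutations (iota 0 c)}.
  move=> _ /mapP[g _ ->]; rewrite mem_permutations; apply: uniq_perm.
  - by rewrite map_inj_uniq ?enum_uniq // => i j /val_inj/perm_inj.
  - exact: iota_uniq.
  move=> i; rewrite mem_iota add0n leq0n /=; apply/mapP/idP => [[j _ ->]|ic].
    exact: ltn_ord.
  by exists ((g^-1)%g (Ordinal ic)); rewrite ?mem_enum ?permKV.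
have [|_ E] := uniq_min_size u sub.
  by rewrite size_permutations ?iota_uniq // size_iota size_map -cardE card_Sn.
by apply: uniq_perm => //; rewrite permutations_uniq.
Qed.

Lemma one_lineK g : perm_of (one_line g) = g.
Proof.
rewrite /perm_of; case: pickP => [h /eqP/one_line_inj//|/(_ g)].
by rewrite eqxx.
Qed.

Lemma perm_ofK l : l \in permutations (iota 0 c) -> one_line (perm_of l) = l.
Proof.
by rewrite -(perm_mem one_line_permutations) => /mapP[g _ ->]; rewrite one_lineK.
Qed.

Lemma perm_ofE l (i : 'I_c) : l \in permutations (iota 0 c) ->
  val (perm_of l i) = nth 0 l i.
Proof. by move=> lP; rewrite -{2}(perm_ofK lP) nth_one_line. Qed.

Lemma sum_one_line (F : 'S_c -> nat) :
  \sum_g F g = \sum_(l <- permutations (iota 0 c)) F (perm_of l).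
Proof.
rewrite -(perm_big _ one_line_permutations) big_map big_enum /=.
by apply: eq_bigr => g _; rewrite one_lineK.
Qed.

(** Conjugacy of [l] to [r] by [s], written without an inverse so that it is a direct check on
    lists. *)
Definition conj_seq l r s : bool :=
  all (fun i => nth 0 s (nth 0 l i) == nth 0 r (nth 0 s i)) (iota 0 c).

Lemma conj_seqP l r s : l \in permutations (iota 0 c) ->
    r \in permutations (iota 0 c) -> s \in permutations (iota 0 c) ->
  conj_seq l r s -> perm_of r = (perm_of l ^ perm_of s)%g.
Proof.
move=> lP rP sP /allP conj; apply/permP=> i; rewrite -[i](permKV (perm_of s)).
rewrite permJ; apply: val_inj; set j := _ i; rewrite !perm_ofE //; apply/esym/eqP/conj.
by rewrite mem_iota leq0n ltn_ord.
Qed.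

End OneLine.

Definition cycle_reps : seq (seq nat) :=
  [:: [:: 0; 1; 2; 3]; [:: 1; 0; 2; 3]; [:: 1; 2; 0; 3]; [:: 1; 0; 3; 2]; [:: 1; 2; 3; 0]].

Definition cycle_rep (l : seq nat) : seq nat :=
  nth [::] cycle_reps
    (find (fun r => has (conj_seq 4 l r) (permutations (iota 0 4))) cycle_reps).

(** The coefficients are the sizes of the conjugacy classes of types 1111, 211, 31, 22 and 4. A
    search through the 24 permutations supplies a conjugator to the representative in each case. *)
Lemma sum_fix_count4 a : \sum_(g : 'S_4) fix_count a g =
  fix_count a (perm_of 4 [:: 0; 1; 2; 3]) + 6 * fix_count a (perm_of 4 [:: 1; 0; 2; 3]) +
  8 * fix_count a (perm_of 4 [:: 1; 2; 0; 3]) + 3 * fix_count a (perm_of 4 [:: 1; 0; 3; 2]) +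
  6 * fix_count a (perm_of 4 [:: 1; 2; 3; 0]).
Proof.
pose P := permutations (iota 0 4).
have ok : all (fun l => (cycle_rep l \in P) && has (conj_seq 4 l (cycle_rep l)) P) P.
  by vm_compute.
have reps : perm_eq (map cycle_rep P) (flatten
    [seq nseq x.1 x.2 | x <- zip [:: 1; 6; 8; 3; 6] cycle_reps]) by vm_compute.
transitivity (\sum_(r <- map cycle_rep P) fix_count a (perm_of 4 r)).
  rewrite sum_one_line big_map; apply: eq_big_seq => l lP.
  have /andP[rP /hasP[s sP ls]] := allP ok l lP.
  by rewrite (conj_seqP lP rP sP ls) fix_count_conj.
rewrite (perm_big _ reps) /= !big_cons big_nil.
lia.
Qed.

(** * Invariant multiplicities *)

Lemma sum_ffun_recl (X : finType) n (F : {ffun 'I_n.+1 -> X} -> nat) :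
  \sum_f F f = \sum_(x : X) \sum_(f : {ffun 'I_n -> X})
    F [ffun i => if unlift ord0 i is Some j then f j else x].
Proof.
rewrite pair_big /=.
rewrite (reindex (fun p : X * {ffun 'I_n -> X} =>
  [ffun i => if unlift ord0 i is Some j then p.2 j else p.1])) //.
exists (fun f : {ffun 'I_n.+1 -> X} => (f ord0, [ffun j => f (lift ord0 j)])) => [[x f]|f] _ /=.
  rewrite ffunE unlift_none; congr pair; apply/ffunP=> j.
  by rewrite !ffunE liftK.
by apply/ffunP=> i; rewrite ffunE; case: unliftP => [j|] ->; rewrite ?ffunE.
Qed.

(** Four nested sums allow the cycles to be summed out one at a time by [conv_sum]. *)
Lemma inv_count4 a r k : r \in permutations (iota 0 4) ->
  inv_count a (perm_of 4 r) k =
  \sum_(x0 < a.+1) \sum_(x1 < a.+1) \sum_(x2 < a.+1) \sum_(x3 < a.+1)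
    (let x := [:: val x0; val x1; val x2; val x3] in
     all (fun i => nth 0 x (nth 0 r i) == nth 0 x i) (iota 0 4) &&
     (k + x0 + x1 + x2 + x3 == a)).
Proof.
move=> rP; rewrite /inv_count -sum1_card.
transitivity (\sum_(n : {ffun 'I_4 -> 'I_a.+1})
   ([forall i, n (perm_of 4 r i) == n i] && (\sum_i n i + k == a) : nat)).
  by rewrite big_mkcond; apply: eq_bigr => n _; rewrite inE; case: ifP.
rewrite sum_ffun_recl; apply: eq_bigr => x0 _.
rewrite sum_ffun_recl; apply: eq_bigr => x1 _.
rewrite sum_ffun_recl; apply: eq_bigr => x2 _.
rewrite sum_ffun_recl; apply: eq_bigr => x3 _.
rewrite (eq_bigr (fun=> nat_of_bool (let x := [:: val x0; val x1; val x2; val x3] in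
     all (fun i => nth 0 x (nth 0 r i) == nth 0 x i) (iota 0 4) &&
     (k + x0 + x1 + x2 + x3 == a)))) => [|f _].
  by rewrite sum_nat_const cardT -cardE card_ffun !card_ord expn0 mul1n.
set n := finfun _; pose x := [:: val x0; val x1; val x2; val x3].
have nE i : val (n i) = nth 0 x i.
  rewrite ffunE; case: unliftP => [{}i|] -> //; rewrite lift0 /=.
  rewrite ffunE; case: unliftP => [{}i|] -> //; rewrite lift0 /=.
  rewrite ffunE; case: unliftP => [{}i|] -> //; rewrite lift0 /=.
  by rewrite ffunE; case: unliftP => [{}i|] -> //; case: i.
congr (nat_of_bool (_ && _)).
  apply/forallP/allP => [inv i|inv i].
    rewrite mem_iota add0n leq0n => i4.
    by have := inv (Ordinal i4); rewrite -val_eqE !nE perm_ofE.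
  by rewrite -val_eqE !nE perm_ofE //; apply: inv; rewrite mem_iota leq0n ltn_ord.
rewrite (eq_bigr (fun i : 'I_4 => nth 0 x i)) => [|i _]; last exact: nE.
by rewrite !big_ord_recl big_ord0 /= addn0 addnC !addnA.
Qed.

(* The generating function of U is that of f divided by 1 - X^c. *)
Lemma conv_sum a c (f U : nat -> nat) y : 0 < c ->
    (forall n, U n = f n + (c <= n) * U (n - c)) ->
  \sum_(x < a.+1) (y + c * x <= a) * f (a - (y + c * x)) = (y <= a) * U (a - y).
Proof.
move=> c0 UE.
(* The range N is separated from n: removing the term x = 0 shortens it by 1 while n drops by c. *)
have main N n : n <= N -> \sum_(x < N.+1) (c * x <= n) * f (n - c * x) = U n.
  elim: N n => [|N IH] n nN.
    by rewrite big_ord1 UE muln0 subn0; case: n nN => //; case: (c) c0 => // ? _ _;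
      rewrite mul0n mul1n addn0.
  rewrite big_ord_recl muln0 subn0 mul1n UE; congr (_ + _).
  have [cn|nc] := leqP c n; last first.
    by rewrite mul0n big1 // => x _; rewrite lift0 mulnS leqNgt ltn_addr.
  rewrite mul1n -(IH (n - c)) ?leq_subLR; last by lia.
  by apply: eq_bigr => x _; rewrite lift0 mulnS leq_subRL // subnDA.
have [ya|ay] := leqP y a; last first.
  by rewrite mul0n big1 // => x _; rewrite leqNgt ltn_addr.
rewrite mul1n -(main a) ?leq_subr //; apply: eq_bigr => x _.
by rewrite leq_subRL // subnDA.
Qed.

Lemma sum_ord_only n (x : 'I_n) (F : 'I_n -> nat) :
  (forall y, y != x -> F y = 0) -> \sum_(y < n) F y = F x.
Proof. by move=> F0; rewrite (bigD1 x) //= big1 ?addn0. Qed.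

Section ClosedForms.

Variables a k : nat.

(** The innermost sum, where [f] is the indicator of 0 with generating function 1. *)
Lemma conv_eq c (U : nat -> nat) y : 0 < c -> (forall n, U n = (n == 0) + (c <= n) * U (n - c)) ->
  \sum_(x < a.+1) (y + c * x == a) = (y <= a) * U (a - y).
Proof.
move=> c0 /(conv_sum a y c0) <-; apply: eq_bigr => x _.
by rewrite subn_eq0 mulnb -eqn_leq.
Qed.

(** The coefficients of X^k/(1 - X)^4: [U1] to [U4] belong to the successive powers of 1/(1 - X),
    and their recurrences are Pascal's rule. *)
Lemma inv_count_1111 :
  inv_count a (perm_of 4 [:: 0; 1; 2; 3]) k = (k <= a) * 'C(a - k + 3, 3).
Proof.
rewrite inv_count4 //.
have U1 n : 1 = (n == 0) + (1 <= n) * 1 by case: n.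
have U2 n : n.+1 = 1 + (1 <= n) * (n - 1).+1 by lia.
have U3 n : 'C(n + 2, 2) = n.+1 + (1 <= n) * 'C(n - 1 + 2, 2).
  by case: n => // n; rewrite subn1 !addnS !addn0 mul1n binS bin1 addnC.
have U4 n : 'C(n + 3, 3) = 'C(n + 2, 2) + (1 <= n) * 'C(n - 1 + 3, 3).
  by case: n => // n; rewrite subn1 !addnS !addn0 mul1n binS addnC.
rewrite -(conv_sum a k (isT : 0 < 1) U4); apply: eq_bigr => x0 _.
rewrite -(conv_sum a _ (isT : 0 < 1) U3); apply: eq_bigr => x1 _.
rewrite -(conv_sum a _ (isT : 0 < 1) U2); apply: eq_bigr => x2 _.
rewrite -(conv_eq _ (isT : 0 < 1) U1); apply: eq_bigr => x3 _.
by rewrite /= !eqxx !mul1n.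
Qed.

(** The series is X^k/((1 - X)^2 (1 - X^2)), and [U3] rests on (n + 4)^2 = (n + 2)^2 + 4(n + 3).
    Invariance leaves only the term [x1 = x0]. *)
Lemma inv_count_211 :
  inv_count a (perm_of 4 [:: 1; 0; 2; 3]) k = (k <= a) * ((a - k + 2) ^ 2 %/ 4).
Proof.
rewrite inv_count4 //.
have U1 n : 1 = (n == 0) + (1 <= n) * 1 by case: n.
have U2 n : n.+1 = 1 + (1 <= n) * (n - 1).+1 by lia.
have U3 n : (n + 2) ^ 2 %/ 4 = n.+1 + (2 <= n) * ((n - 2 + 2) ^ 2 %/ 4).
  case: n => [|[|n]] //; rewrite subn2 mul1n /=.
  have -> : (n.+2 + 2) ^ 2 = (n + 2) ^ 2 + n.+3 * 4 by ring.
  by rewrite divnDMl // addnC.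
rewrite -(conv_sum a k (isT : 0 < 2) U3); apply: eq_bigr => x0 _.
rewrite (sum_ord_only (x := x0)) => [|x1 N]; last first.
  by rewrite big1 // => x2 _; rewrite big1 // => x3 _; rewrite /= val_eqE (negPf N).
rewrite -(conv_sum a _ (isT : 0 < 1) U2); apply: eq_bigr => x2 _.
rewrite -(conv_eq _ (isT : 0 < 1) U1); apply: eq_bigr => x3 _.
by rewrite /= !eqxx mul2n -addnn !mul1n !addnA.
Qed.

(** The series is X^k/((1 - X)(1 - X^3)). *)
Lemma inv_count_31 :
  inv_count a (perm_of 4 [:: 1; 2; 0; 3]) k = (k <= a) * ((a - k) %/ 3).+1.
Proof.
rewrite inv_count4 //.
have U1 n : 1 = (n == 0) + (1 <= n) * 1 by case: n.
have U2 n : (n %/ 3).+1 = 1 + (3 <= n) * ((n - 3) %/ 3).+1 by lia.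
rewrite -(conv_sum a k (isT : 0 < 3) U2); apply: eq_bigr => x0 _.
rewrite (sum_ord_only (x := x0)) => [|x1 N]; last first.
  by rewrite big1 // => x2 _; rewrite big1 // => x3 _; rewrite /= val_eqE (negPf N).
rewrite (sum_ord_only (x := x0)) => [|x2 N]; last first.
  by rewrite big1 // => x3 _; rewrite /= eqxx val_eqE (negPf N).
rewrite -(conv_eq _ (isT : 0 < 1) U1); apply: eq_bigr => x3 _.
by rewrite /= !eqxx; congr (nat_of_bool (_ == _)); lia.
Qed.

(** The series is X^k/(1 - X^2)^2, one factor for each transposition. *)
Lemma inv_count_22 :
  inv_count a (perm_of 4 [:: 1; 0; 3; 2]) k =
  (k <= a) * (~~ odd (a - k) * ((a - k) %/ 2).+1).
Proof.
rewrite inv_count4 //.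
have U1 n : ~~ odd n = (n == 0) + (2 <= n) * ~~ odd (n - 2) :> nat.
  by case: n => [|[|n]] //; rewrite subn2 mul1n /= negbK.
have U2 n : ~~ odd n * (n %/ 2).+1 =
    ~~ odd n + (2 <= n) * (~~ odd (n - 2) * ((n - 2) %/ 2).+1).
  case: n => [|[|n]] //; rewrite subn2 mul1n /= negbK.
  by case: (odd n) => //=; rewrite !mul1n; lia.
rewrite -(conv_sum a k (isT : 0 < 2) U2); apply: eq_bigr => x0 _.
rewrite (sum_ord_only (x := x0)) => [|x1 N]; last first.
  by rewrite big1 // => x2 _; rewrite big1 // => x3 _; rewrite /= val_eqE (negPf N).
rewrite -(conv_eq _ (isT : 0 < 2) U1); apply: eq_bigr => x2 _.
rewrite (sum_ord_only (x := x2)) => [|x3 N]; last by rewrite /= !eqxx val_eqE (negPf N).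
by rewrite /= !eqxx; congr (nat_of_bool (_ == _)); lia.
Qed.

(** The series is X^k/(1 - X^4). *)
Lemma inv_count_4 :
  inv_count a (perm_of 4 [:: 1; 2; 3; 0]) k = (k <= a) * (4 %| a - k).
Proof.
rewrite inv_count4 //.
have U1 n : 4 %| n = (n == 0) + (4 <= n) * (4 %| n - 4) :> nat.
  by have [|] := leqP 4 n; [move=> /[dup] n4 /dvdn_subr|]; lia.
rewrite -(conv_eq k (isT : 0 < 4) U1); apply: eq_bigr => x0 _.
rewrite (sum_ord_only (x := x0)) => [|x1 N]; last first.
  by rewrite big1 // => x2 _; rewrite big1 // => x3 _; rewrite /= val_eqE (negPf N).
rewrite (sum_ord_only (x := x0)) => [|x2 N]; last first.
  by rewrite big1 // => x3 _; rewrite /= eqxx val_eqE (negPf N).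
rewrite (sum_ord_only (x := x0)) => [|x3 N]; last by rewrite /= !eqxx val_eqE (negPf N).
by rewrite /= !eqxx; congr (nat_of_bool (_ == _)); lia.
Qed.

End ClosedForms.

(** * The closed formula *)

(** On four coatoms the weights run from 1, the single edge of size 4, to 6, all pairs; [cs] holds
    the number of invariant hypergraphs of each weight. *)
Lemma fix_count4 a r (cs : seq nat) : r \in permutations (iota 0 4) ->
    perm_eq [seq weight_seq 4 l | l <- sublists (edges 4) & lin_seq 4 l && inv_seq 4 r l]
      (flatten [seq nseq x.1 x.2 | x <- zip cs (iota 1 6)]) ->
  fix_count a (perm_of 4 r) =
  \sum_(x <- zip cs (iota 1 6)) x.1 * inv_count a (perm_of 4 r) x.2.
Proof.
move=> rP ws; rewrite /fix_count (@sum_hyp _ _ r) => [|i]; last exact: perm_ofE.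
rewrite (perm_big _ ws) big_flatten big_map /=; apply: eq_bigr => x _.
by rewrite big_nseq iter_addn_0 mulnC.
Qed.

(* One sum for each cycle type 1111, 211, 31, 22, 4, multiplied by the number of such
   permutations; the lists count the invariant linear hypergraphs of weight 1, ..., 6. *)
Lemma R4_burnside a : R 4 a * 24 =
  \sum_(x <- zip [:: 1; 19; 46; 24; 6; 1] (iota 1 6))
    x.1 * ((x.2 <= a) * 'C(a - x.2 + 3, 3)) +
  6 * (\sum_(x <- zip [:: 1; 5; 8; 8; 2; 1] (iota 1 6))
    x.1 * ((x.2 <= a) * ((a - x.2 + 2) ^ 2 %/ 4))) +
  8 * (\sum_(x <- zip [:: 1; 1; 1; 3; 0; 1] (iota 1 6))
    x.1 * ((x.2 <= a) * ((a - x.2) %/ 3).+1)) +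
  3 * (\sum_(x <- zip [:: 1; 3; 6; 4; 2; 1] (iota 1 6))
    x.1 * ((x.2 <= a) * (~~ odd (a - x.2) * ((a - x.2) %/ 2).+1))) +
  6 * (\sum_(x <- zip [:: 1; 1; 0; 2; 0; 1] (iota 1 6))
    x.1 * ((x.2 <= a) * (4 %| a - x.2))).
Proof.
rewrite (burnside a (isT : 0 < 4)) sum_fix_count4.
rewrite (@fix_count4 a _ [:: 1; 19; 46; 24; 6; 1]); [|by vm_compute..].
rewrite (@fix_count4 a _ [:: 1; 5; 8; 8; 2; 1]); [|by vm_compute..].
rewrite (@fix_count4 a _ [:: 1; 1; 1; 3; 0; 1]); [|by vm_compute..].
rewrite (@fix_count4 a _ [:: 1; 3; 6; 4; 2; 1]); [|by vm_compute..].
rewrite (@fix_count4 a _ [:: 1; 1; 0; 2; 0; 1]); [|by vm_compute..].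
congr (_ + 6 * _ + 8 * _ + 3 * _ + 6 * _); apply: eq_bigr => x _.
- by rewrite inv_count_1111.
- by rewrite inv_count_211.
- by rewrite inv_count_31.
- by rewrite inv_count_22.
- by rewrite inv_count_4.
Qed.

(** Below 6 some conditions [x.2 <= a] fail, so these values are evaluated directly. *)
Lemma R4_small a : a < 6 -> R 4 a = nth 0 [:: 0; 1; 4; 13; 34; 68] a.
Proof.
move=> a6; apply/eqP; rewrite -(eqn_pmul2r (isT : 0 < 24)) R4_burnside !big_cons !big_nil.
by case: a a6 => [|[|[|[|[|[|a]]]]]] // _; vm_compute.
Qed.

Import GRing.Theory Num.Theory.
Local Open Scope ring_scope.

(** * Closed counts as rational expressions on residue classes modulo 12 *)

Section Rationals.

Implicit Types n q t : nat.

Lemma rat_bin3 n :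
  'C(n + 3, 3)%:R = (n%:R + 1) * (n%:R + 2) * (n%:R + 3) / 6 :> rat.
Proof.
have : ('C(n + 3, 3) * 6 = (n + 1) * (n + 2) * (n + 3))%N.
  by rewrite -[6%N]/(3`!)%N bin_ffact !ffactnS ffactn0 !addnS addn0 /=; ring.
move/(congr1 (fun k => k%:R / 6 : rat)); rewrite natrM mulfK // => ->.
by rewrite !natrM !natrD.
Qed.

Lemma sq_mod4 m : ((m + 2) ^ 2 %% 4 = odd m)%N.
Proof.
rewrite -{1}(odd_double_half m) -muln2; case: (odd m) => /=.
  have -> : ((1 + m./2 * 2 + 2) ^ 2 = (m./2 * m./2 + 3 * m./2 + 2) * 4 + 1)%N by ring.
  by rewrite modnMDl.
have -> : ((0 + m./2 * 2 + 2) ^ 2 = (m./2 + 1) ^ 2 * 4)%N by ring.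
by rewrite modnMl.
Qed.

(** The remainder from [sq_mod4] makes the floor exact; the parity is that of [t] because 12 is
    even. *)
Lemma rat_sq4 q t :
  (((12 * q + t) + 2) ^ 2 %/ 4)%:R =
    (((12 * q + t)%:R + 2) ^+ 2 - (odd t)%:R) / 4 :> rat.
Proof.
have /(congr1 (fun k => k%:R : rat)) := divn_eq ((12 * q + t + 2) ^ 2) 4.
rewrite sq_mod4 oddD oddM /= natrD [X in _ = X + _]natrM natrX natrD => ->.
by rewrite addrK mulfK.
Qed.

Lemma rat_div3 q t :
  ((12 * q + t) %/ 3).+1%:R = 4 * q%:R + (t %/ 3).+1%:R :> rat.
Proof.
have -> : ((12 * q + t) %/ 3 = 4 * q + t %/ 3)%N by lia.
by ring.
Qed.

Lemma rat_div2 q t : ((12 * q + t) %/ 2).+1%:R = 6 * q%:R + (t %/ 2).+1%:R :> rat.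
Proof.
have -> : ((12 * q + t) %/ 2 = 6 * q + t %/ 2)%N by lia.
by ring.
Qed.

Lemma rat_odd q t : (~~ odd (12 * q + t))%:R = (~~ odd t)%:R :> rat.
Proof. by rewrite oddD oddM. Qed.

Lemma rat_dvd4 q t : (4 %| 12 * q + t)%N%:R = (4 %| t)%N%:R :> rat.
Proof. by have -> : (4 %| 12 * q + t)%N = (4 %| t)%N by lia. Qed.

End Rationals.

Theorem theorem7p5 (a : nat) :
  (R 4 a)%:R =
    97 / 144 * a%:R ^+ 3 - 5 / 6 * a%:R ^+ 2
    + bracket [:: 44 / 48; 47 / 48] a * a%:R
    + 1 / 72 * bracket [:: 0; 13; 8; -45; 40; -19; 0; -5; 8; -27; 40; -37] a
  :> rat.
Proof.
have [a6|a6] := ltnP a 6.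
  rewrite (R4_small a6); case: a a6 => [|[|[|[|[|[|a]]]]]] a6; last by [];
    by apply/eqP; vm_compute.
(* Residues are taken between 6 and 17 so that [s - k] is a true difference for every weight [k] up
   to 6. *)
have [q [s [s6 s18 ->]]] : exists q s, [/\ (6 <= s)%N, (s < 18)%N & a = (12 * q + s)%N].
  by exists ((a - 6) %/ 12)%N, ((a - 6) %% 12 + 6)%N; split; lia.
have subE k : (k <= 6)%N -> (12 * q + s - k = 12 * q + (s - k))%N by lia.
have leE k : (k <= 6)%N -> (k <= 12 * q + s)%N = true by lia.
have mod12 : ((12 * q + s) %% 12 = s %% 12)%N by lia.
have mod2 : ((12 * q + s) %% 2 = s %% 2)%N by lia.
have /(congr1 (fun k => k%:R : rat)) := R4_burnside (12 * q + s).
rewrite !big_cons !big_nil /= /bracket [size _]/= [X in (_ %% X)%N]/= mod12 mod2.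
move: (R 4 _) => N; do 6! rewrite leE //; do 6! rewrite subE //.
rewrite !mul1n !mul0n !add0n !addn0 !(natrD, natrM).
rewrite !(rat_bin3, rat_sq4, rat_div3, rat_div2, rat_odd, rat_dvd4) !(natrD, natrM).
move/(canRL (mulfK (isT : 24%:R != 0 :> rat))) => ->.
(* With s fixed to one of twelve values, what remains is a polynomial identity in x. *)
move: (q%:R : rat) => x; case: s s6 s18 {subE leE mod12 mod2} => [|[|[|[|[|[|s]]]]]] // _.
do 12? [case: s => [|s]]; last by [].
all: move=> _.
(* Evaluates the closed natural-number expressions, so that [field] meets only numerals and x. *)
all: repeat match goal with
  | |- context [subn ?m ?n] => let v := eval vm_compute in (subn m n) in change (subn m n) with v
  | |- context [divn ?m ?n] => let v := eval vm_compute in (divn m n) in change (divn m n) with v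
  | |- context [modn ?m ?n] => let v := eval vm_compute in (modn m n) in change (modn m n) with v
  | |- context [nat_of_bool ?b] =>
      let v := eval vm_compute in (nat_of_bool b) in change (nat_of_bool b) with v
  end.
all: cbn [nth].
all: by field.
Qed.
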